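(* Let $\Lambda$ be a finitely generated nonamenable group whose first $\ell^2$-Betti number vanishes. Then for any discrete faithful representation $\varphi$ of $\Lambda$ into $\mathrm{SO}(n,1)$ or $\mathrm{SU}(n,1)$ ($n\ge2$), the image has critical exponent $\delta(\varphi(\Lambda))\ge 2$. Moreover, if $\delta(\varphi(\Lambda))=2$, then the image is of divergent type, that is, $\sum_{\lambda\in\varphi(\Lambda)}e^{-2d(\lambda o,o)}=\infty$.
   Context: For $n\ge 2$, $\mathrm{SO}(n,1)$ denotes the identity component of the subgroup of $\mathrm{SL}_{n+1}(\mathbb{R})$ preserving the form $x_1^2+\dots+x_n^2-x_{n+1}^2$, and $\mathrm{SU}(n,1)$ the subgroup of $\mathrm{SL}_{n+1}(\mathbb{C})$ preserving $|x_1|^2+\dots+|x_n|^2-|x_{n+1}|^2$. For $G$ one of these groups and $K<G$ maximal compact, $G/K$ is real (resp. complex) hyperbolic $n$-space. It carries the $G$-invariant Riemannian distance $d$ normalized to have constant sectional curvature $-1$ in the real case and maximal sectional curvature $-1$ (values in $[-4,-1]$) in the complex case. Let $o=eK$. The critical exponent of a discrete subgroup $\Lambda<G$ is $\delta(\Lambda)=\inf\{s\ge 0\mid\sum_{\lambda\in\Lambda}e^{-s\,d(\lambda o,o)}<\infty\}$. *)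

(* Defs.v *)
From HB Require Import structures.
From mathcomp Require Import all_boot all_order all_algebra.
From mathcomp Require Import complex.
From mathcomp Require Import all_classical all_reals all_analysis.

Set Implicit Arguments.
Unset Strict Implicit.
Unset Printing Implicit Defensive.

Import Order.TTheory GRing.Theory Num.Theory numFieldNormedType.Exports.

Local Open Scope classical_set_scope.
Local Open Scope ring_scope.
Local Open Scope complex_scope.

Section Groups.
Context (L : groupType).

Definition generates (k : nat) (S : 'I_k -> L) : Prop :=
  forall H : set L,
    H 1%g ->
    (forall x y, H x -> H y -> H (x * y)%g) ->
    (forall x, H x -> H x^-1%g) ->
    (forall j, H (S j)) ->
    H = setT.

Definition amenable (R : realType) : Prop :=
  exists m : set L -> R,
    [/\ forall A, 0 <= m A,
        m setT = 1,
        forall A B, A `&` B = set0 -> m (A `|` B) = m A + m B &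
        forall g A, m [set (g * x)%g | x in A] = m A].

End Groups.

Section SquareSummable.
Context (R : realType) (I : choiceType).
Implicit Types (u v : I -> R[i]) (V : set (I -> R[i])).

Definition l2 u : Prop :=
  (\esum_(i in [set: I]) (Normc.normc (u i) ^+ 2)%:E < +oo)%E.

(* Sum of an absolutely summable family, computed from the sums of its
   positive and negative parts; meaningless for other families. *)
Definition rsum (f : I -> R) : R :=
  fine (\esum_(i in [set: I]) (Num.max (f i) 0)%:E) -
  fine (\esum_(i in [set: I]) (Num.max (- f i) 0)%:E).

Definition csum (f : I -> R[i]) : R[i] :=
  rsum (fun i => complex.Re (f i)) +i* rsum (fun i => complex.Im (f i)).

Definition l2dot u v : R[i] := csum (fun i => u i * (v i)^*).

Definition l2delta (i : I) : I -> R[i] := fun j => (i == j)%:R.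

(* Orthogonal projection of u on V; it exists for V a closed subspace of l2
   and u in l2, and the value is the zero function when it does not exist. *)
Definition orth_proj V u : I -> R[i] :=
  xget (fun=> 0)
    [set p | V p /\ forall v, V v -> l2dot (fun i => u i - p i) v = 0].

End SquareSummable.

Section FirstL2Betti.
Context (R : realType) (L : groupType).

Definition lreg (g : L) (u : L -> R[i]) : L -> R[i] :=
  fun x => u (g^-1 * x)%g.

(* 1-cocycles of L with values in the left regular representation on l2(L) *)
Definition l2cocycle (b : L -> L -> R[i]) : Prop :=
  (forall g, l2 (b g)) /\
  (forall g h x, b (g * h)%g x = b g x + lreg g (b h) x).

(* Murray-von Neumann dimension of a closed subspace V of l2(L)^k that is
   invariant under right translations by L: the trace of the orthogonal
   projection on V. *)
Definition vn_dim (k : nat) (V : set (L * 'I_k -> R[i])) : R :=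
  \sum_(j < k)
    complex.Re (l2dot (orth_proj V (l2delta R (1%g, j))) (l2delta R (1%g, j))).

Section GeneratingFamily.
Context (k : nat) (S : 'I_k -> L).

(* A cocycle is determined by its values on a generating family S, and
   b |-> (b (S j))_j identifies Z^1(L, l2(L)), with the topology of pointwise
   convergence, with a closed subspace of l2(L)^k. *)
Definition l2Z1 : set (L * 'I_k -> R[i]) :=
  [set c | exists2 b, l2cocycle b & forall x j, c (x, j) = b (S j) x].

Definition l2B1 : set (L * 'I_k -> R[i]) :=
  [set c | exists2 u, l2 u & forall x j, c (x, j) = lreg (S j) u x - u x].

(* The reduced cohomology Z^1 / closure(B^1) is realized as the orthogonal
   complement of B^1 in Z^1. *)
Definition l2H1 : set (L * 'I_k -> R[i]) :=
  [set c | l2Z1 c /\ forall d, l2B1 d -> l2dot c d = 0].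

(* First l2-Betti number of L, when S generates L; it does not depend on S. *)
Definition l2betti1 : R := vn_dim l2H1.

End GeneratingFamily.
End FirstL2Betti.

Arguments l2betti1 R {L k} S.

Definition discrete_set (T : topologicalType) (A : set T) : Prop :=
  forall x, A x -> isolated A x.

Definition faithful_rep (F : comPzRingType) (n : nat) (L : groupType)
    (G : set 'M[F]_n) (phi : L -> 'M[F]_n) : Prop :=
  [/\ forall g, G (phi g),
      forall g h, phi (g * h)%g = phi g *m phi h &
      injective phi].

Section PoincareSeries.
Context (R : realType) (T : choiceType).

Definition poincare (D : T -> R) (A : set T) (s : R) : \bar R :=
  \esum_(g in A) (expR (- (s * D g)))%:E.

Definition critical_exponent (D : T -> R) (A : set T) : \bar R :=
  ereal_inf [set s%:E | s in [set s : R | 0 <= s /\ (poincare D A s < +oo)%E]].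

End PoincareSeries.

Definition origin (F : pzRingType) (n : nat) : 'cV[F]_n.+1 :=
  delta_mx ord_max ord0.

Definition C1 (R : realType) (m : nat) (c : R -> 'cV[R]_m.+1) : Prop :=
  (forall t, derivable c t 1) /\ continuous (derive1 c).

Section Real.
Context (R : realType) (n : nat).
Implicit Types (x y : 'cV[R]_n.+1) (c : R -> 'cV[R]_n.+1).

Definition lorentz x : R :=
  \sum_(i < n.+1 | i != ord_max) x i ord0 ^+ 2 - x ord_max ord0 ^+ 2.

Definition SO1 : set 'M[R]_n.+1 :=
  connected_component
    [set A : 'M[R]_n.+1 |
      \det A = 1 /\ forall x, lorentz (A *m x) = lorentz x] 1%:M.

(* Hyperboloid model of SO1/K, K being the stabilizer of the origin. The
   Riemannian metric is the restriction of the form to the tangent spaces,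
   which has constant curvature -1. *)
Definition hyperboloid : set 'cV[R]_n.+1 :=
  [set x | lorentz x = -1 /\ 0 < x ord_max ord0].

Definition rlength c : R :=
  \int[lebesgue_measure]_(t in `[0, 1]) Num.sqrt (lorentz (derive1 c t)).

Definition rdist x y : R :=
  inf [set l | exists c, [/\ C1 c, forall t, hyperboloid (c t),
                             c 0 = x, c 1 = y & l = rlength c]].

Definition rdisp (A : 'M[R]_n.+1) : R := rdist (A *m origin R n) (origin R n).

End Real.

Section Complex.
Context (R : realType) (n : nat).
Implicit Types (z w v : 'cV[R[i]]_n.+1) (c : R -> 'cV[R[i]]_n.+1).

Definition herm z w : R[i] :=
  \sum_(i < n.+1 | i != ord_max) z i ord0 * (w i ord0)^* -
  z ord_max ord0 * (w ord_max ord0)^*.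

Definition hform z : R :=
  \sum_(i < n.+1 | i != ord_max) Normc.normc (z i ord0) ^+ 2 -
  Normc.normc (z ord_max ord0) ^+ 2.

Definition SU1 : set 'M[R[i]]_n.+1 :=
  [set A : 'M[R[i]]_n.+1 |
    \det A = 1 /\ forall z, hform (A *m z) = hform z].

Definition re_curve c : R -> 'cV[R]_n.+1 := fun t => map_mx (@complex.Re R) (c t).
Definition im_curve c : R -> 'cV[R]_n.+1 := fun t => map_mx (@complex.Im R) (c t).

Definition velocity c (t : R) : 'cV[R[i]]_n.+1 :=
  \col_i (derive1 (re_curve c) t i ord0 +i* derive1 (im_curve c) t i ord0).

(* Projective model of SU1/K: points are the complex lines spanned by vectors z
   with hform z < 0, K being the stabilizer of the line of the origin. bergman
   is the squared length of the image of v in the tangent space at the line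
   of z. On the chart z = (u, 1) with n = 1 the metric is
   |du|^2 / (1 - |u|^2)^2, of curvature -4, and the real points form a totally
   geodesic real hyperbolic space of curvature -1, so that the sectional
   curvature takes its values in [-4, -1]. *)
Definition bergman z v : R :=
  (Normc.normc (herm v z) ^+ 2 - hform v * hform z) / hform z ^+ 2.

Definition clength c : R :=
  \int[lebesgue_measure]_(t in `[0, 1]) Num.sqrt (bergman (c t) (velocity c t)).

Definition same_line z w : Prop := exists2 a : R[i], a != 0 & w = a *: z.

(* Curves of lines are given by lifts, and clength does not depend on the
   lift. *)
Definition cdist z w : R :=
  inf [set l | exists c,
    [/\ C1 (re_curve c) /\ C1 (im_curve c), forall t, hform (c t) < 0,
        same_line z (c 0), same_line w (c 1) & l = clength c]].

Definition cdisp (A : 'M[R[i]]_n.+1) : R :=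
  cdist (A *m origin R[i] n) (origin R[i] n).

End Complex.

(* Main.v *)
Require Import Defs.
From HB Require Import structures.
From mathcomp Require Import all_boot all_order all_algebra.
From mathcomp Require Import complex.
From mathcomp Require Import all_classical all_reals all_analysis.
From mathcomp Require Import ring lra.

Import Order.TTheory GRing.Theory Num.Theory numFieldNormedType.Exports.

Local Open Scope classical_set_scope.
Local Open Scope ring_scope.
Local Open Scope complex_scope.

Set Implicit Arguments.
Unset Strict Implicit.
Unset Printing Implicit Defensive.

(* With a(g) the modulus of the corner entry of phi(g), that is the hyperbolic
   cosine of d(phi(g) o, o), convergence of the Poincare series at 2 means that
   the sum of the a(g)^-2 is finite. The coordinates F of the orbit points
   phi(g) o in the ball model satisfy |F(yg) - F(y)| <= a(g) / a(yg), so
   g |-> (x |-> F(x^-1 g) - F(x^-1)) is a cocycle with values in l2(L).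

   Nonamenability gives a spectral gap for the regular representation, hence
   H^1(L, l2(L)) is equal to its reduced version, which vanishes with the first
   l2-Betti number. The cocycle is therefore a coboundary, and the whole orbit
   converges to a single boundary point. It follows that a(gx) / a(x) has a
   limit as x goes to infinity; the limit is 1, because multiplication by g
   cannot decrease a by a definite factor outside a finite set. The truncated
   functions min(1 / a, e) are then almost invariant in l2(L), contradicting
   the spectral gap. Only an upper bound for the distance is needed, and it is
   obtained from one explicit geodesic. *)

(** The exponent 2 is the square in square summability. With [A g] the squared modulus of the corner
    entry, the cocycle at [g] has squared modulus at most [A g / A (x^-1 * g)], and the distance
    bound gives 1 / [A] at most 4 exp(-2d); so convergence at 2 puts the cocycle in l2. Refuting
    this convergence settles both claims at once, since displacements are nonnegative and the series
    can only decrease when the exponent grows. The limit of a(gx) / a(x) is the modulus of the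
    pairing of the last row of [phi g] with the limit point, a horospherical multiplier. The
    classical ending is that the group fixes a boundary point, and that discrete subgroups of such a
    stabilizer are amenable. Here this structure theory is replaced by explicit vectors: 1 / a is
    square summable but nearly invariant only off a finite set, and truncating it below its values
    on that set and on its translates makes it constant there. All estimates are made once, for the
    Hermitian form; real matrices are read over the complex numbers. *)

Section Sums.
Context (R : realType) (I : choiceType).
Implicit Types (f g p q : I -> R).

Definition rsummable f : Prop := (\esum_(i in [set: I]) `|f i|%:E < +oo)%E.

Lemma rsummable_fin f : rsummable f -> (forall i, 0 <= f i) ->
  (\esum_(i in [set: I]) (f i)%:E)%E \is a fin_num.
Proof.
move=> sf f0; rewrite ge0_fin_numE; last by apply: esum_ge0 => i _; rewrite lee_fin.
apply: le_lt_trans sf; apply: le_esum => i _.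
by rewrite lee_fin ler_norm.
Qed.

Lemma rsummable_le f g : (forall i, `|f i| <= g i) -> rsummable g -> rsummable f.
Proof.
move=> fg; apply: le_lt_trans; apply: le_esum => i _.
by rewrite lee_fin (le_trans (fg i))// ler_norm.
Qed.

Lemma rsummable_norm f : rsummable f -> rsummable (fun i => `|f i|).
Proof. by apply: le_lt_trans; apply: le_esum => i _; rewrite normr_id. Qed.

Lemma rsummable0 : rsummable (fun=> 0).
Proof. by rewrite /rsummable esum1// => i _; rewrite normr0. Qed.

Lemma rsummableD f g :
  rsummable f -> rsummable g -> rsummable (fun i => f i + g i).
Proof.
move=> sf sg.
have : (\esum_(i in [set: I]) (`|f i|%:E + `|g i|%:E) < +oo)%E.
  by rewrite esumD ?lte_add_pinfty// => i _; rewrite lee_fin.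
by apply: le_lt_trans; apply: le_esum => i _; rewrite -EFinD lee_fin ler_normD.
Qed.

Lemma rsummableN f : rsummable f -> rsummable (fun i => - f i).
Proof. by apply: le_lt_trans; apply: le_esum => i _; rewrite normrN. Qed.

Lemma rsummableB f g :
  rsummable f -> rsummable g -> rsummable (fun i => f i - g i).
Proof. by move=> sf sg; apply: rsummableD => //; exact: rsummableN. Qed.

(** Independence of the decomposition: [p] plus the negative part of [f] equals [q] plus its
    positive part, and sums of nonnegative families are additive. Linearity of [rsum] follows from
    this. *)
Lemma rsum_sub p q f : rsummable p -> rsummable q ->
  (forall i, 0 <= p i) -> (forall i, 0 <= q i) -> (forall i, f i = p i - q i) ->
  rsum f = fine (\esum_(i in [set: I]) (p i)%:E) -
           fine (\esum_(i in [set: I]) (q i)%:E).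
Proof.
move=> sp sq p0 q0 fE; rewrite /rsum.
have le_p i : `|Num.max (f i) 0| <= p i.
  rewrite fE ger0_norm ?le_max ?lexx ?orbT// ge_max p0 andbT.
  by rewrite lerBlDr lerDl.
have le_q i : `|Num.max (- f i) 0| <= q i.
  rewrite fE ger0_norm ?le_max ?lexx ?orbT// ge_max q0 andbT opprB.
  by rewrite lerBlDr lerDl.
have s1 := rsummable_le le_p sp; have s2 := rsummable_le le_q sq.
have max0 (x : R) : 0 <= Num.max x 0 by rewrite le_max lexx orbT.
apply/eqP; rewrite subr_eq addrAC eq_sym subr_eq -!fineD ?rsummable_fin//.
apply/eqP; congr fine.
rewrite -!esumD; do ?by move=> i _; rewrite lee_fin.
apply: eq_esum => i _; rewrite -!EFinD; congr EFin; rewrite fE.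
by case: (lerP (p i - q i) 0) => h; case: (lerP (- (p i - q i)) 0) => h'; lra.
Qed.

Lemma rsum_ge0E f : rsummable f -> (forall i, 0 <= f i) ->
  rsum f = fine (\esum_(i in [set: I]) (f i)%:E).
Proof.
move=> sf f0; rewrite (rsum_sub sf rsummable0)//.
  by rewrite [X in _ - fine X]esum1//= subr0.
by move=> i; rewrite subr0.
Qed.

Lemma rsum_ge0 f : (forall i, 0 <= f i) -> 0 <= rsum f.
Proof.
move=> f0; rewrite /rsum [X in _ - fine X]esum1 ?subr0.
  by apply/fine_ge0/esum_ge0 => i _; rewrite lee_fin le_max lexx orbT.
by move=> i _; congr EFin; apply/max_idPr; rewrite oppr_le0.
Qed.

Lemma eq_rsum f g : (forall i, f i = g i) -> rsum f = rsum g.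
Proof. by move=> fg; congr rsum; apply/funext. Qed.

Lemma rsum_posneg f : rsummable f -> exists p q,
  [/\ rsummable p, rsummable q, forall i, 0 <= p i, forall i, 0 <= q i &
      forall i, f i = p i - q i].
Proof.
move=> sf; exists (fun i => Num.max (f i) 0), (fun i => Num.max (- f i) 0).
split=> [||i|i|i]; rewrite ?le_max ?lexx ?orbT//.
- apply: rsummable_le (rsummable_norm sf) => i.
  by rewrite ger0_norm ?le_max ?lexx ?orbT// ge_max ler_norm normr_ge0.
- apply: rsummable_le (rsummable_norm sf) => i.
  by rewrite ger0_norm ?le_max ?lexx ?orbT// ge_max ler_normr lexx orbT normr_ge0.
- by case: (lerP (f i) 0) => h; case: (lerP (- (f i)) 0) => h'; lra.
Qed.

Lemma rsumD f g : rsummable f -> rsummable g ->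
  rsum (fun i => f i + g i) = rsum f + rsum g.
Proof.
move=> /rsum_posneg[p [q [sp sq p0 q0 fE]]].
move=> /rsum_posneg[p' [q' [sp' sq' p'0 q'0 gE]]].
rewrite (rsum_sub sp sq p0 q0 fE) (rsum_sub sp' sq' p'0 q'0 gE).
rewrite (rsum_sub (rsummableD sp sp') (rsummableD sq sq'));
  do ?by move=> i; rewrite ?addr_ge0.
  under eq_esum do rewrite EFinD.
  under [in X in _ - fine X]eq_esum do rewrite EFinD.
  rewrite !esumD; do ?by move=> i _; rewrite lee_fin.
  by rewrite !fineD ?rsummable_fin//; ring.
by move=> i; rewrite fE gE; ring.
Qed.

Lemma rsumN f : rsummable f -> rsum (fun i => - f i) = - rsum f.
Proof.
move=> /rsum_posneg[p [q [sp sq p0 q0 fE]]].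
rewrite (rsum_sub sp sq p0 q0 fE) (rsum_sub sq sp)// ?opprB// => i.
by rewrite fE opprB.
Qed.

Lemma rsumB f g : rsummable f -> rsummable g ->
  rsum (fun i => f i - g i) = rsum f - rsum g.
Proof. by move=> sf sg; rewrite rsumD ?rsumN//; exact: rsummableN. Qed.

Lemma le_rsum f g : rsummable f -> rsummable g -> (forall i, f i <= g i) ->
  rsum f <= rsum g.
Proof.
move=> sf sg fg; rewrite -subr_ge0 -rsumB//.
by apply: rsum_ge0 => i; rewrite subr_ge0.
Qed.

Lemma fsum_le_rsum f (s : seq I) : rsummable f -> (forall i, 0 <= f i) ->
  uniq s -> \sum_(i <- s) f i <= rsum f.
Proof.
move=> sf f0 us; rewrite rsum_ge0E// -lee_fin fineK ?rsummable_fin//.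
apply: esum_ge; exists [set` s]; first by split => //; exact: finite_seq.
by rewrite -fsbig_seq//= sumEFin.
Qed.

Lemma le_rsum1 f i : rsummable f -> (forall i, 0 <= f i) -> f i <= rsum f.
Proof. by move=> sf f0; have := @fsum_le_rsum f [:: i] sf f0 isT; rewrite big_seq1. Qed.

(** A nonnegative sum is the supremum of its finite partial sums, so a uniform bound on these gives
    summability and the estimate together. *)
Lemma rsum_le f (M : R) : (forall i, 0 <= f i) ->
  (forall s, uniq s -> \sum_(i <- s) f i <= M) -> rsummable f /\ rsum f <= M.
Proof.
move=> f0 fM.
have h : (\esum_(i in [set: I]) (f i)%:E <= M%:E)%E.
  apply: ge_ereal_sup => _ [A [finA _] <-].
  by rewrite fsbig_finite//= sumEFin lee_fin fM// finmap.fset_uniq.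
have sf : rsummable f.
  apply: le_lt_trans (ltry M); apply: le_trans h.
  by apply: le_esum => i _; rewrite ger0_norm.
by split=> //; rewrite rsum_ge0E// -lee_fin fineK ?rsummable_fin.
Qed.

Lemma rsummableZ (c : R) f : rsummable f -> rsummable (fun i => c * f i).
Proof.
move=> sf; have [h _] : rsummable (fun i => `|c * f i|) /\
    rsum (fun i => `|c * f i|) <= `|c| * rsum (fun i => `|f i|).
  apply: rsum_le => // s us; under eq_bigr do rewrite normrM.
  rewrite -mulr_sumr ler_wpM2l// fsum_le_rsum//.
  exact: rsummable_norm.
by apply: le_lt_trans h; apply: le_esum => i _; rewrite normr_id.
Qed.

Lemma rsumZ (c : R) f : rsummable f -> rsum (fun i => c * f i) = c * rsum f.
Proof.
have H g d : rsummable g -> (forall i, 0 <= g i) -> 0 <= d ->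
    rsum (fun i => d * g i) <= d * rsum g.
  move=> sg g0 d0; have [//||//] := @rsum_le (fun i => d * g i) (d * rsum g).
    by move=> i; rewrite mulr_ge0.
  by move=> s us; rewrite -mulr_sumr ler_wpM2l// fsum_le_rsum.
have E g d : rsummable g -> (forall i, 0 <= g i) -> 0 <= d ->
    rsum (fun i => d * g i) = d * rsum g.
  move=> sg g0 d0; apply/eqP; rewrite eq_le H//=.
  have {d0} [->|d_gt0] : d = 0 \/ 0 < d.
    by move: d0; rewrite le_eqVlt => /orP[/eqP->|]; [left|right].
    by rewrite mul0r rsum_ge0// => i; rewrite mul0r.
  (* The reverse inequality is [H] again, for the family [d * g i] and the factor [d^-1]. *)
  rewrite (_ : rsum g = rsum (fun i => d^-1 * (d * g i))); last first.
    by apply: eq_rsum => i; rewrite mulrA mulVf ?mul1r// gt_eqF.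
  rewrite mulrC -ler_pdivlMr// mulrC; apply: H; rewrite ?invr_ge0 ?(ltW d_gt0)//.
    exact: rsummableZ.
  by move=> i; rewrite mulr_ge0// ltW.
have P d g : 0 <= d -> rsummable g -> rsum (fun i => d * g i) = d * rsum g.
  move=> d0 /rsum_posneg[p [q [sp sq p0 q0 fE]]].
  rewrite (@eq_rsum _ (fun i => d * p i - d * q i)); last first.
    by move=> i; rewrite fE; ring.
  rewrite rsumB ?E//; do ?exact: rsummableZ.
  by rewrite (eq_rsum fE) rsumB//; ring.
move=> sf; case: (lerP 0 c) => [c0|c0]; first exact: P.
rewrite (@eq_rsum _ (fun i => - (- c * f i))); last by move=> i; ring.
by rewrite rsumN ?P ?oppr_ge0 ?(ltW c0)//; [ring|exact: rsummableZ].
Qed.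

Lemma rsum0 : rsum (fun _ : I => 0 : R) = 0.
Proof.
rewrite -[RHS](mul0r (rsum (fun _ : I => 0))) -(rsumZ 0 rsummable0).
by apply: eq_rsum => i; rewrite mul0r.
Qed.

Lemma rsum_eq0 f : rsummable f -> (forall i, 0 <= f i) -> rsum f = 0 ->
  forall i, f i = 0.
Proof. by move=> sf f0 s0 i; apply/le_anti; rewrite f0 -s0 le_rsum1. Qed.

Lemma rsum1 f i0 : (forall i, i != i0 -> f i = 0) ->
  rsummable f /\ rsum f = f i0.
Proof.
move=> fi0.
have H g : (forall i, 0 <= g i) -> (forall i, i != i0 -> g i = 0) ->
    rsummable g /\ rsum g = g i0.
  move=> g0 gi0.
  have [sg gle] : rsummable g /\ rsum g <= g i0.
    apply: rsum_le => // s us; have [is0|is0] := boolP (i0 \in s).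
      by rewrite (bigD1_seq i0)//= big1// addr0.
    rewrite big_seq big1// => i ins; apply: gi0; apply: contraNneq is0.
    by move=> <-.
  by split=> //; apply/le_anti; rewrite gle le_rsum1.
have [||sp pE] := H (fun i => Num.max (f i) 0).
- by move=> i; rewrite le_max lexx orbT.
- by move=> i /fi0 ->; rewrite maxxx.
have [||sq qE] := H (fun i => Num.max (- f i) 0).
- by move=> i; rewrite le_max lexx orbT.
- by move=> i /fi0 ->; rewrite oppr0 maxxx.
have fE i : f i = Num.max (f i) 0 - Num.max (- f i) 0.
  by case: (lerP (f i) 0) => h; case: (lerP (- (f i)) 0) => h'; lra.
split; last by rewrite (eq_rsum fE) rsumB// pE qE -fE.
by rewrite (_ : f = fun i => Num.max (f i) 0 - Num.max (- f i) 0);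
  [exact: rsummableB|exact/funext].
Qed.

(** Markov's inequality: more than [M / e] terms of size [e] would exceed the total [M]. Convergence
    at infinity on the group is always expressed through such finite exceptional sets. *)
Lemma rsummable_finite f (e : R) : rsummable f -> 0 < e ->
  finite_set [set i | e <= `|f i|].
Proof.
move=> sf e0; apply: contrapT => infA.
set M := rsum (fun i => `|f i|).
have M0 : 0 <= M / e by rewrite divr_ge0 ?rsum_ge0// ltW.
have [B BA sB] := infinite_set_fset (Num.Def.archi_bound (M / e)) infA.
have : e * (size (finmap.enum_fset B))%:R <= M.
  apply: le_trans (fsum_le_rsum (rsummable_norm sf) _ (finmap.fset_uniq B)) => //.
  rewrite mulr_natr (_ : _ *+ _ = \sum_(i <- finmap.enum_fset B) e); last first.
    by rewrite big_const_seq count_predT iter_addr_0.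
  rewrite big_seq [leRHS]big_seq.
  by apply: ler_sum => i iB; apply: BA.
rewrite leNgt => /negP; apply; rewrite -ltr_pdivrMl// mulrC.
by apply: lt_le_trans (archi_boundP M0) _; rewrite ler_nat.
Qed.

End Sums.

Lemma rsummable_reindex (R : realType) (I J : choiceType) (e : J -> I)
    (f : I -> R) : bijective e -> rsummable (fun j => f (e j)) <-> rsummable f.
Proof.
move=> be; rewrite /rsummable (@reindex_esum _ J I setT setT e)//.
by rewrite setTT_bijective.
Qed.

Lemma rsum_reindex (R : realType) (I J : choiceType) (e : J -> I)
    (f : I -> R) : bijective e -> rsum (fun j => f (e j)) = rsum f.
Proof.
by move=> be; rewrite /rsum; congr (fine _ - fine _); symmetry;
  apply: reindex_esum; rewrite setTT_bijective.
Qed.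

Lemma real_cauchy_cvg (R : realType) (a : nat -> R) :
  (forall e, 0 < e -> exists N, forall m n, (N <= m)%N -> (N <= n)%N ->
     `|a m - a n| <= e) ->
  exists l, forall e, 0 < e -> exists N, forall n, (N <= n)%N -> `|a n - l| <= e.
Proof.
move=> ca; have : cvg (a @ \oo).
  apply/cauchy_cvgP/cauchy_exP => e e0.
  have [N NP] := ca (e / 2) (divr_gt0 e0 (ltr0n _ 2)).
  exists (a N), N => // n /= Nn; rewrite /ball /=.
  by apply: le_lt_trans (NP _ _ (leqnn N) Nn) _; lra.
move=> /cvgrPdist_le cvga; exists (lim (a @ \oo)) => e e0.
by have [N _ NP] := cvga e e0; exists N => n Nn; rewrite distrC; exact: NP.
Qed.

(** * Square-summable functions as a real Hilbert space *)

Section Hilbert.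
Context (R : realType) (I : choiceType).
Implicit Types (u v w : I -> R[i]) (V : set (I -> R[i])).

(** The squared modulus, written as a polynomial in the real and imaginary parts so that identities
    reduce to [ring]. *)
Definition nsq (z : R[i]) : R := complex.Re z ^+ 2 + complex.Im z ^+ 2.

Lemma nsqE z : Normc.normc z ^+ 2 = nsq z.
Proof. by case: z => a b; rewrite /= sqr_sqrtr// addr_ge0 ?sqr_ge0. Qed.

Lemma nsq_ge0 z : 0 <= nsq z.
Proof. by rewrite addr_ge0 ?sqr_ge0. Qed.

Lemma nsq_eq0 z : nsq z = 0 -> z = 0.
Proof.
case: z => a b; rewrite /nsq /= => /eqP.
by rewrite paddr_eq0 ?sqr_ge0// !sqrf_eq0 => /andP[/eqP-> /eqP->].
Qed.

Lemma nsq0 : nsq 0 = 0.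
Proof. by rewrite /nsq /= expr0n /= addr0. Qed.

Lemma nsqM z z' : nsq (z * z') = nsq z * nsq z'.
Proof. by case: z z' => a b [c d]; rewrite /nsq; simpc => /=; ring. Qed.

Lemma nsqN z : nsq (- z) = nsq z.
Proof. by case: z => a b; rewrite /nsq; simpc => /=; ring. Qed.

Lemma nsqD_le z z' : nsq (z + z') <= 2 * nsq z + 2 * nsq z'.
Proof.
case: z z' => a b [c d]; rewrite /nsq; simpc => /=; rewrite -subr_ge0.
rewrite (_ : _ - _ = (a - c) ^+ 2 + (b - d) ^+ 2); last by ring.
by rewrite addr_ge0 ?sqr_ge0.
Qed.

(** The real part of [l2dot]. Complex orthogonality to a complex subspace is recovered by testing
    also against ['i] times its vectors. *)
Definition rdot u v : R :=
  rsum (fun i => complex.Re (u i) * complex.Re (v i) +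
                 complex.Im (u i) * complex.Im (v i)).

(** This is the square of the norm; accordingly the triangle inequality appears below with factors
    2. *)
Definition nrm u : R := rsum (fun i => nsq (u i)).

Lemma l2P u : l2 u <-> rsummable (fun i => nsq (u i)).
Proof.
rewrite /l2 /rsummable.
suff -> : (\esum_(i in [set: I]) (Normc.normc (u i) ^+ 2)%:E)%E =
          (\esum_(i in [set: I]) `|nsq (u i)|%:E)%E by [].
by apply: eq_esum => i _; rewrite nsqE ger0_norm ?nsq_ge0.
Qed.

Lemma l2_le u (f : I -> R) : (forall i, nsq (u i) <= f i) -> rsummable f -> l2 u.
Proof.
by move=> uf sf; apply/l2P; apply: rsummable_le sf => i; rewrite ger0_norm ?nsq_ge0.
Qed.

Lemma l2D u v : l2 u -> l2 v -> l2 (fun i => u i + v i).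
Proof.
move=> /l2P su /l2P sv; apply: l2_le (fun i => nsqD_le (u i) (v i)) _.
by apply: rsummableD; apply: rsummableZ.
Qed.

Lemma l2Z (c : R[i]) u : l2 u -> l2 (fun i => c * u i).
Proof.
move=> /l2P su; apply: (@l2_le _ (fun i => nsq c * nsq (u i))).
  by move=> i; rewrite nsqM.
exact: rsummableZ.
Qed.

Lemma l2N u : l2 u -> l2 (fun i => - u i).
Proof. by move=> /l2P su; apply: l2_le su => i; rewrite nsqN. Qed.

Lemma l2B u v : l2 u -> l2 v -> l2 (fun i => u i - v i).
Proof. by move=> lu lv; apply: l2D => //; exact: l2N. Qed.

Lemma l2_0 : l2 (fun _ : I => 0 : R[i]).
Proof. by apply: l2_le (rsummable0 R I) => i; rewrite nsq0. Qed.

Lemma rdot_summable u v : l2 u -> l2 v ->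
  rsummable (fun i => complex.Re (u i) * complex.Re (v i) +
                      complex.Im (u i) * complex.Im (v i)).
Proof.
move=> /l2P su /l2P sv; apply: rsummable_le (rsummableD su sv) => i.
case: (u i) (v i) => a b [c d]; rewrite /nsq /= ler_norml.
have := sqr_ge0 (a - c); have := sqr_ge0 (b - d).
have := sqr_ge0 (a + c); have := sqr_ge0 (b + d).
have := sqr_ge0 a; have := sqr_ge0 b; have := sqr_ge0 c; have := sqr_ge0 d.
by rewrite !expr2 => *; apply/andP; split; nra.
Qed.

Lemma Re_l2dot u v : complex.Re (l2dot u v) = rdot u v.
Proof.
by apply: eq_rsum => i; case: (u i) (v i) => a b [c d]; simpc.
Qed.

Lemma Im_l2dot u v : complex.Im (l2dot u v) = rdot u (fun i => 'i * v i).
Proof.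
apply: eq_rsum => i; rewrite -complexiE.
by case: (u i) (v i) => a b [c d]; simpc => /=; ring.
Qed.

Lemma rdotxx u : rdot u u = nrm u.
Proof. by apply: eq_rsum => i. Qed.

Lemma rdotC u v : rdot u v = rdot v u.
Proof. by apply: eq_rsum => i; ring. Qed.

Lemma rdotBl u v w : l2 u -> l2 v -> l2 w ->
  rdot (fun i => u i - v i) w = rdot u w - rdot v w.
Proof.
move=> lu lv lw; rewrite /rdot -rsumB; try exact: rdot_summable.
by apply: eq_rsum => i; case: (u i) (v i) => a b [c d] /=; ring.
Qed.

Lemma rdotDl u v w : l2 u -> l2 v -> l2 w ->
  rdot (fun i => u i + v i) w = rdot u w + rdot v w.
Proof.
move=> lu lv lw; rewrite /rdot -rsumD; try exact: rdot_summable.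
by apply: eq_rsum => i; case: (u i) (v i) => a b [c d] /=; ring.
Qed.

Lemma rdotZl (z : R[i]) u v :
  rdot (fun i => z * u i) v = rdot u (fun i => z^* * v i).
Proof.
apply: eq_rsum => i.
by case: z (u i) (v i) => a b [c d] [e f]; simpc => /=; ring.
Qed.

Lemma nrm_ge0 u : 0 <= nrm u.
Proof. by apply: rsum_ge0 => i; exact: nsq_ge0. Qed.

Lemma nsq_le_nrm u i : l2 u -> nsq (u i) <= nrm u.
Proof. by move=> /l2P su; apply: le_rsum1 su _ => j; exact: nsq_ge0. Qed.

Lemma nrm_eq0 u : l2 u -> nrm u = 0 -> forall i, u i = 0.
Proof.
move=> lu u0 i; apply: nsq_eq0; apply/le_anti; rewrite nsq_ge0 andbT -u0.
exact: nsq_le_nrm.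
Qed.

Lemma eq_nrm u v : (forall i, u i = v i) -> nrm u = nrm v.
Proof. by move=> uv; apply: eq_rsum => i; rewrite uv. Qed.

Lemma nrm_distC u v : nrm (fun i => u i - v i) = nrm (fun i => v i - u i).
Proof. by apply: eq_rsum => i; rewrite -nsqN opprB. Qed.

Lemma nrmD_le u v : l2 u -> l2 v ->
  nrm (fun i => u i + v i) <= 2 * nrm u + 2 * nrm v.
Proof.
move=> lu lv; have /l2P su := lu; have /l2P sv := lv.
have z1 := rsummableZ 2 su; have z2 := rsummableZ 2 sv.
rewrite /nrm -!rsumZ// -(rsumD z1 z2).
have /l2P suv := l2D lu lv.
by apply: (le_rsum suv (rsummableD z1 z2)) => i; exact: nsqD_le.
Qed.

Lemma nrmB_le u v w : l2 u -> l2 v -> l2 w ->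
  nrm (fun i => u i - w i) <=
    2 * nrm (fun i => u i - v i) + 2 * nrm (fun i => v i - w i).
Proof.
move=> lu lv lw; apply: le_trans (nrmD_le (l2B lu lv) (l2B lv lw)).
by rewrite (@eq_nrm _ (fun i => u i - v i + (v i - w i)))// => i; rewrite subrKA.
Qed.

Lemma nrm_line u v (t : R) : l2 u -> l2 v ->
  nrm (fun i => u i - t%:C * v i) = nrm u - 2 * t * rdot u v + t ^+ 2 * nrm v.
Proof.
move=> lu lv; have /l2P su := lu; have /l2P sv := lv.
have suv := rdot_summable lu lv.
have z1 := rsummableZ (2 * t) suv; have z2 := rsummableZ (t ^+ 2) sv.
rewrite /nrm /rdot -!rsumZ// -(rsumB su z1) -(rsumD (rsummableB su z1) z2).
by apply: eq_rsum => i; case: (u i) (v i) => a b [c d]; rewrite /nsq; simpc => /=; ring.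
Qed.

Lemma parallelogram u v w : l2 u -> l2 v -> l2 w ->
  nrm (fun i => v i - w i) =
  2 * nrm (fun i => u i - v i) + 2 * nrm (fun i => u i - w i)
  - 4 * nrm (fun i => u i - (2^-1)%:C * (v i + w i)).
Proof.
move=> lu lv lw.
have lm : l2 (fun i => u i - (2^-1)%:C * (v i + w i)).
  by apply: l2B => //; apply: l2Z; exact: l2D.
have /l2P s1 := l2B lu lv; have /l2P s2 := l2B lu lw; have /l2P s3 := lm.
have z1 := rsummableZ 2 s1; have z2 := rsummableZ 2 s2.
rewrite /nrm -!rsumZ// -(rsumD z1 z2) -(rsumB (rsummableD z1 z2) (rsummableZ 4 s3)).
apply: eq_rsum => i; case: (u i) (v i) (w i) => a b [c d] [e f].
by rewrite /nsq; simpc => /=; field.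
Qed.

Lemma rdot_sqr_le u v : l2 u -> l2 v -> rdot u v ^+ 2 <= nrm u * nrm v.
Proof.
move=> lu lv; have [v0|v0] := eqVneq (nrm v) 0.
  have vE := nrm_eq0 lv v0; rewrite v0 mulr0 (_ : rdot u v = 0) ?expr0n//.
  rewrite -(rsum0 R I); apply: eq_rsum => i.
  by rewrite vE /= !mulr0 addr0.
(* Cauchy-Schwarz: this coefficient minimizes the squared norm along the direction [v], and
   multiplying by [nrm v] clears the denominator. *)
have := nrm_ge0 (fun i => u i - (rdot u v / nrm v)%:C * v i).
rewrite nrm_line//; set a := nrm u; set b := nrm v; set c := rdot u v => h.
have b0 : 0 < b by rewrite lt_neqAle eq_sym v0 nrm_ge0.
have {h} : 0 <= b * (a - 2 * (c / b) * c + (c / b) ^+ 2 * b).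
  by rewrite mulr_ge0// ltW.
rewrite (_ : b * _ = a * b - c ^+ 2) ?subr_ge0//.
by field; rewrite v0.
Qed.

End Hilbert.

Lemma natSinv_lt (R : realType) (e : R) : 0 < e ->
  exists N, forall n, (N <= n)%N -> n.+1%:R^-1 < e.
Proof.
move=> e0; exists (Num.Def.archi_bound e^-1) => n Nn.
rewrite invf_plt ?posrE//; apply: lt_le_trans (archi_boundP _) _.
  by rewrite invr_ge0 ltW.
by rewrite ler_nat (leq_trans Nn).
Qed.

(** * Completeness and orthogonal projection *)

Section Completeness.
Context (R : realType) (I : choiceType).
Implicit Types (u w x : I -> R[i]) (v : nat -> I -> R[i]) (V : set (I -> R[i])).

Definition l2cauchy v : Prop :=
  forall e : R, 0 < e -> exists N, forall m n, (N <= m)%N -> (N <= n)%N ->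
    nrm (fun i => v m i - v n i) <= e.

Definition l2lim v w : Prop :=
  forall e : R, 0 < e -> exists N, forall n, (N <= n)%N ->
    nrm (fun i => v n i - w i) <= e.

Lemma l2lim_cauchy v w : (forall n, l2 (v n)) -> l2 w -> l2lim v w -> l2cauchy v.
Proof.
move=> lv lw vw e e0; have [N NP] := vw (e / 4) ltac:(lra).
exists N => m n Nm Nn; have := nrmB_le (lv m) lw (lv n).
by rewrite (nrm_distC w); have := NP _ Nm; have := NP _ Nn; lra.
Qed.

Lemma l2lim_unique v w w' : (forall n, l2 (v n)) -> l2 w -> l2 w' ->
  l2lim v w -> l2lim v w' -> forall i, w i = w' i.
Proof.
move=> lv lw lw' vw vw' i; apply/eqP; rewrite -subr_eq0; apply/eqP.
apply: (@nrm_eq0 R I (fun i => w i - w' i)); first exact: l2B.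
apply/le_anti; rewrite nrm_ge0 andbT; apply/ler_addgt0Pr => e e0; rewrite add0r.
have [N NP] := vw (e / 4) ltac:(lra); have [M MP] := vw' (e / 4) ltac:(lra).
have := nrmB_le lw (lv (maxn N M)) lw'; rewrite (nrm_distC w (v _)).
by have := NP _ (leq_maxl N M); have := MP _ (leq_maxr N M); lra.
Qed.

Lemma sqr_le_small (x e : R) : 0 <= e -> x ^+ 2 <= e ^+ 2 -> `|x| <= e.
Proof.
by move=> e0 xe; rewrite -(@ler_pXn2r _ 2)// ?nnegrE// real_normK ?num_real.
Qed.

(** The limit is taken coordinate by coordinate, and the Cauchy bound passes to it on each finite
    set of indices, uniformly in the set. *)
Lemma l2_complete v : (forall n, l2 (v n)) -> l2cauchy v ->
  exists2 w, l2 w & l2lim v w.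
Proof.
move=> lv cv.
have coord (h : R[i] -> R) : (forall z z', h (z - z') = h z - h z') ->
    (forall z, h z ^+ 2 <= nsq z) ->
    forall i, exists l, forall e : R, 0 < e -> exists N, forall n, (N <= n)%N ->
      `|h (v n i) - l| <= e.
  move=> hB hle i; apply: (@real_cauchy_cvg R (fun n => h (v n i))) => e e0.
  have [N NP] := cv (e ^+ 2) (exprn_gt0 _ e0).
  exists N => m n Nm Nn; apply: sqr_le_small; first exact: ltW.
  rewrite -hB; apply: le_trans (hle _) _; apply: le_trans (NP _ _ Nm Nn).
  exact: (@nsq_le_nrm R I (fun i => v m i - v n i) i (l2B (lv m) (lv n))).
have [||a aP] := choice (coord (@complex.Re R) _ _).
- by move=> [? ?] [? ?].
- by move=> [x y]; rewrite /nsq /= lerDl sqr_ge0.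
have [||b bP] := choice (coord (@complex.Im R) _ _).
- by move=> [? ?] [? ?].
- by move=> [x y]; rewrite /nsq /= lerDr sqr_ge0.
pose w i := a i +i* b i.
have fsum_small s e : 0 < e -> exists N, forall n, (N <= n)%N ->
    \sum_(i <- s) nsq (v n i - w i) <= e.
  elim: s e => [|i s IHs] e e0; first by exists 0%N => n _; rewrite big_nil ltW.
  have [N NP] := IHs (e / 2) ltac:(lra).
  have e1 : 0 < Num.min 1 (e / 4) by rewrite lt_min ltr01 divr_gt0.
  have [N1 N1P] := aP i _ e1; have [N2 N2P] := bP i _ e1.
  exists (maxn N (maxn N1 N2)) => n; rewrite !geq_max => /and3P[nN nN1 nN2].
  have small (x : R) : `|x| <= Num.min 1 (e / 4) -> x ^+ 2 <= e / 4.
    rewrite le_min -real_normK ?num_real// => /andP[x1 xe].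
    by rewrite expr2; have := normr_ge0 x; nra.
  rewrite big_cons; have := NP _ nN; have := small _ (N1P _ nN1).
  have := small _ (N2P _ nN2); rewrite /nsq /w.
  by case: (v n i) => x y /=; lra.
have bound e : 0 < e -> exists N, forall n, (N <= n)%N ->
    rsummable (fun i => nsq (v n i - w i)) /\ nrm (fun i => v n i - w i) <= e.
  move=> e0; have [N NP] := cv (e / 4) ltac:(lra).
  exists N => n Nn; apply: rsum_le => [i|s us]; first exact: nsq_ge0.
  (* [M] depends on the finite set [s] but the final bound does not: going through [v m] costs twice
     [e / 4] for each of the two differences. *)
  have [M MP] := fsum_small s (e / 4) ltac:(lra).
  have h1 := MP _ (leq_maxr N M); have h2 := NP _ _ Nn (leq_maxl N M).
  set m := maxn N M in h1 h2.
  have /l2P sB := l2B (lv n) (lv m).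
  have h3 : \sum_(i <- s) nsq (v n i - v m i) <= e / 4.
    by apply: le_trans h2; apply: fsum_le_rsum => // i; exact: nsq_ge0.
  apply: (@le_trans _ _ (2 * \sum_(i <- s) nsq (v n i - v m i) +
                         2 * \sum_(i <- s) nsq (v m i - w i))); last by lra.
  rewrite !mulr_sumr -big_split /=; apply: ler_sum => i _.
  by rewrite -(subrKA (v m i)); exact: nsqD_le.
exists w; last first.
  by move=> e e0; have [N NP] := bound e e0; exists N => n /NP[].
have [N NP] := bound 1 ltr01; have [/l2P sN _] := NP N (leqnn N).
have : l2 (fun i => v N i - (v N i - w i)) by exact: l2B.
by move=> /l2P h; apply: l2_le h => i; rewrite opprB addrCA subrr addr0.
Qed.

Lemma rdot_lim v w x : (forall n, l2 (v n)) -> l2 w -> l2 x -> l2lim v w ->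
  forall e : R, 0 < e -> exists N, forall n, (N <= n)%N ->
    `|rdot (v n) x - rdot w x| <= e.
Proof.
move=> lv lw lx vw e e0.
have B0 : 0 < nrm x + 1 by rewrite ltr_wpDl ?nrm_ge0.
have [N NP] := vw (e ^+ 2 / (nrm x + 1)) (divr_gt0 (exprn_gt0 2 e0) B0).
exists N => n Nn; apply: sqr_le_small; first exact: ltW.
rewrite -rdotBl//; apply: le_trans (rdot_sqr_le (l2B (lv n) lw) lx) _.
apply: le_trans (ler_wpM2r (nrm_ge0 x) (NP n Nn)) _.
by rewrite mulrAC ler_pdivrMr// ler_wpM2l ?sqr_ge0// lerDl.
Qed.

Lemma l2lim_subl v w u : l2lim v w ->
  l2lim (fun n i => u i - v n i) (fun i => u i - w i).
Proof.
move=> vw e e0; have [N NP] := vw e e0; exists N => n Nn.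
rewrite (@eq_nrm _ _ _ (fun i => w i - v n i)) => [|i]; last first.
  by rewrite opprB addrC addrA subrK.
by rewrite nrm_distC; exact: NP.
Qed.

Definition l2closed V : Prop :=
  forall v w, (forall n, V (v n)) -> l2 w -> l2lim v w -> V w.

(** A minimizing sequence for the distance to [V] is Cauchy by the parallelogram law. Only real
    scalars are used; complex orthogonality is added where [V] is a complex subspace. *)
Lemma real_projection V u : V `<=` @l2 R I -> V (fun=> 0) ->
  (forall w x, V w -> V x -> V (fun i => w i + x i)) ->
  (forall (t : R) w, V w -> V (fun i => t%:C * w i)) ->
  l2closed V -> l2 u ->
  exists2 p, V p & forall w, V w -> rdot (fun i => u i - p i) w = 0.
Proof.
move=> Vl2 V0 VD VZ Vcl lu.
pose D := [set nrm (fun i => u i - v i) | v in V].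
have D0 : D !=set0 by exists (nrm (fun i => u i - 0)), (fun=> 0).
have Dlb : has_lbound D by exists 0 => _ [v _ <-]; exact: nrm_ge0.
set d := inf D.
have dle w : V w -> d <= nrm (fun i => u i - w i).
  by move=> Vw; apply: ge_inf => //; exists w.
have /choice[v vP] : forall n : nat, exists w,
    V w /\ nrm (fun i => u i - w i) < d + n.+1%:R^-1.
  move=> n.
  have [|_ [w Vw <-] wlt] := @inf_adherent _ D n.+1%:R^-1 _ (conj D0 Dlb).
    by rewrite invr_gt0.
  by exists w.
have Vv n : V (v n) by case: (vP n).
have lv n : l2 (v n) by exact: Vl2.
have vlt n : nrm (fun i => u i - v n i) < d + n.+1%:R^-1 by case: (vP n).
have [p lp vp] : exists2 p, l2 p & l2lim v p.
  apply: l2_complete => // e e0.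
  have [N NP] := natSinv_lt (divr_gt0 e0 (ltr0n R 4)).
  exists N => m n /NP hm /NP hn.
  (* The midpoint lies in [V], so the subtracted term is at least [4 * d], and only twice the two
     excesses over [d] remains. *)
  rewrite (parallelogram lu (lv m) (lv n)).
  have := dle _ (VZ 2^-1 _ (VD _ _ (Vv m) (Vv n))).
  by move: (vlt m) (vlt n) hm hn; move: m.+1%:R^-1 n.+1%:R^-1 => a b; lra.
have Vp : V p := Vcl v p Vv lp vp.
exists p => // w Vw; have lw := Vl2 _ Vw.
set c := rdot _ w; set B := nrm w.
have B0 : 0 <= B := nrm_ge0 w.
(* First variation: [v n + t * w] lies in [V], hence is no closer to [u] than [d]. The error [e]
   absorbs the passage from [v n] to the limit [p]. *)
have key (t e : R) : 0 < e -> 2 * t * c <= t ^+ 2 * B + e.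
  move=> e0; pose e' := e / (4 * (`|t| + 1)).
  have t1 : 0 < `|t| + 1 by rewrite ltr_wpDl.
  have e'0 : 0 < e' by rewrite divr_gt0// mulr_gt0.
  have [N NP] := rdot_lim (fun n => l2B lu (lv n)) (l2B lu lp) lw (l2lim_subl u vp) e'0.
  have [M MP] := natSinv_lt (divr_gt0 e0 (ltr0n R 4)).
  set n := maxn N M; have h1 := NP n (leq_maxl _ _).
  have h2 := MP n (leq_maxr _ _).
  have h3 := dle _ (VD _ _ (Vv n) (VZ t _ Vw)).
  rewrite (@eq_nrm _ _ _ (fun i => u i - v n i - t%:C * w i)) in h3; last first.
    by move=> i; rewrite opprD addrA.
  rewrite nrm_line// in h3; last exact: l2B.
  have h4 : nrm (fun i => u i - v n i) < d + e / 4.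
    by apply: lt_trans (vlt n) _; rewrite ltrD2l.
  have h5 : 2 * t * (c - rdot (fun i => u i - v n i) w) <= e / 2.
    apply: le_trans (ler_norm _) _; rewrite !normrM distrC.
    apply: le_trans (ler_wpM2l _ h1) _; first by rewrite mulr_ge0.
    rewrite (ger0_norm (ler0n R 2)) /e' mulrA ler_pdivrMr ?mulr_gt0//.
    by have := normr_ge0 t; nra.
  by rewrite -/B in h3; lra.
have B1 : 0 < B + 1 by lra.
apply/eqP; rewrite -sqrf_eq0 eq_le sqr_ge0 andbT; apply/ler_addgt0Pr => e e0; rewrite add0r.
(* Dividing by [B + 1] avoids the case [B = 0]; the error is scaled so that the inequality becomes
   [c ^+ 2 <= e]. *)
have := key (c / (B + 1)) (e * (B + 2) / (B + 1) ^+ 2).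
rewrite divr_gt0 ?mulr_gt0 ?exprn_gt0//; last by lra.
move=> /(_ isT); rewrite -subr_ge0.
rewrite (_ : _ - _ = (e - c ^+ 2) * ((B + 2) / (B + 1) ^+ 2)); last first.
  by field; rewrite gt_eqF.
rewrite pmulr_lge0 ?subr_ge0// divr_gt0 ?exprn_gt0//; lra.
Qed.

End Completeness.

(** One ultrafilter serves all bounded sequences simultaneously, by compactness of the unit
    interval; this makes the limits of masses additive in the set. *)
Lemma ultralimit (R : realType) : exists2 U : set_system nat,
  ProperFilter U /\ \oo `<=` U &
  forall a : nat -> R, (forall n, 0 <= a n <= 1) -> exists l : R, a @ U --> l.
Proof.
have [U [ultraU ooU]] := ultraFilterLemma (@eventually_filter).
have properU : ProperFilter U by apply: ultra_proper.
exists U => // a a01.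
have [|l [_ cl]] := @segment_compact R 0 1 (a @ U) _.
  by apply: (@filterS _ U _ setT) (@filterT _ U _) => n _; have := a01 n; rewrite /= in_itv.
exists l => B nB; have [//|nU] := in_ultra_setVsetC (a @^-1` B) ultraU.
have [x [/= nBx Bx]] := cl (~` B) B nU nB.
by case: nBx.
Qed.

(** * From nonamenability to a spectral gap *)

Section Reiter.
Context (R : realType) (L : groupType).
Implicit Types (p : L -> R) (A : set L).

Definition mass p A : R := rsum (fun x => (x \in A)%:R * p x).

Lemma mass_summable p A : rsummable p -> (forall x, 0 <= p x) ->
  rsummable (fun x => (x \in A)%:R * p x).
Proof.
move=> sp p0; apply: rsummable_le sp => x.
by case: (x \in A); rewrite ?mul1r ?mul0r ?normr0// ger0_norm.
Qed.

Lemma mass_ge0 p A : (forall x, 0 <= p x) -> 0 <= mass p A.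
Proof. by move=> p0; apply: rsum_ge0 => x; rewrite mulr_ge0. Qed.

Lemma mass_le p A : rsummable p -> (forall x, 0 <= p x) -> mass p A <= rsum p.
Proof.
move=> sp p0; apply: (le_rsum (mass_summable A sp p0) sp) => x.
by case: (x \in A); rewrite ?mul1r ?mul0r.
Qed.

Lemma massT p : mass p setT = rsum p.
Proof. by apply: eq_rsum => x; rewrite in_setT mul1r. Qed.

Lemma massU p A B : rsummable p -> (forall x, 0 <= p x) ->
  A `&` B = set0 -> mass p (A `|` B) = mass p A + mass p B.
Proof.
move=> sp p0 AB.
rewrite /mass -(rsumD (mass_summable A sp p0) (mass_summable B sp p0)).
apply: eq_rsum => x; rewrite -mulrDl in_setU; congr (_ * _).
have := in_set0 x; rewrite -AB in_setI.
by case: (x \in A); case: (x \in B) => //= _; rewrite ?addr0 ?add0r.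
Qed.

Lemma bij_mulg (g : L) : bijective (fun x => g * x)%g.
Proof. by exists (fun x => g^-1 * x)%g => x; [rewrite mulKg|rewrite mulgA mulgV mul1g]. Qed.

Lemma mem_translate (g x : L) A : ((g * x)%g \in [set (g * y)%g | y in A]) = (x \in A).
Proof.
apply/idP/idP; rewrite !inE; last by exists x.
by move=> [y Ay] /(congr1 (fun z => g^-1 * z)%g); rewrite !mulKg => <-.
Qed.

Lemma mass_translate p g A : rsummable p -> (forall x, 0 <= p x) ->
  `|mass p [set (g * x)%g | x in A] - mass p A| <=
  rsum (fun x => `|p (g * x)%g - p x|).
Proof.
move=> sp p0.
have spg : rsummable (fun x => p (g * x)%g) by apply/(rsummable_reindex _ (bij_mulg g)).
have sd := rsummable_norm (rsummableB spg sp).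
have -> : mass p [set (g * x)%g | x in A] = mass (fun x => p (g * x)%g) A.
  rewrite /mass -(rsum_reindex _ (bij_mulg g)).
  by apply: eq_rsum => x; rewrite mem_translate.
have s1 := mass_summable A spg (fun x => p0 _); have s2 := mass_summable A sp p0.
have le_abs x : (x \in A)%:R * p (g * x)%g - (x \in A)%:R * p x <= `|p (g * x)%g - p x|.
  by case: (x \in A); rewrite ?mul1r ?mul0r ?subr0 ?ler_norm.
have le_absN x : (x \in A)%:R * p x - (x \in A)%:R * p (g * x)%g <= `|p (g * x)%g - p x|.
  by rewrite distrC; case: (x \in A); rewrite ?mul1r ?mul0r ?subr0 ?ler_norm.
rewrite /mass ler_norml lerNl opprB -(rsumB s1 s2) -(rsumB s2 s1).
by apply/andP; split; apply: le_rsum => //; exact: rsummableB.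
Qed.

(** Weighted arithmetic-geometric mean applied to [(x - y) * (x + y)]. The free weight [t] stands in
    for Cauchy-Schwarz when an l2 defect is turned into an l1 defect. *)
Lemma sqr_diff_le (t x y : R) : 0 < t ->
  `|x ^+ 2 - y ^+ 2| <= t^-1 * (x - y) ^+ 2 + t * (x ^+ 2 + y ^+ 2).
Proof.
move=> t0; have t0' : t != 0 by rewrite gt_eqF.
rewrite ler_norml; apply/andP; split; rewrite -subr_ge0.
  rewrite (_ : _ - _ = 2^-1 * (t^-1 * (x - y + t * (x + y)) ^+ 2 +
    t^-1 * (x - y) ^+ 2 + t * (x - y) ^+ 2)); last by field.
  by do ?[exact: sqr_ge0|exact: ltW|apply: addr_ge0|apply: mulr_ge0];
  rewrite ?invr_ge0 ?ler0n ?(ltW t0).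
rewrite (_ : _ - _ = 2^-1 * (t^-1 * (x - y - t * (x + y)) ^+ 2 +
  t^-1 * (x - y) ^+ 2 + t * (x - y) ^+ 2)); last by field.
by do ?[exact: sqr_ge0|exact: ltW|apply: addr_ge0|apply: mulr_ge0];
  rewrite ?invr_ge0 ?ler0n ?(ltW t0).
Qed.

Lemma nsq_diff_le (t : R) (z z' : R[i]) : 0 < t ->
  `|nsq z - nsq z'| <= t^-1 * nsq (z - z') + t * (nsq z + nsq z').
Proof.
case: z z' => x y [x' y'] t0; rewrite /nsq; simpc => /=.
have := sqr_diff_le x x' t0; have := sqr_diff_le y y' t0.
by rewrite !ler_norml => /andP[h1 h2] /andP[h3 h4]; apply/andP; split; lra.
Qed.

Lemma l2_translate (g : L) (u : L -> R[i]) : l2 u -> l2 (fun x => u (g * x)%g).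
Proof.
move=> /l2P su; apply/l2P.
exact/(rsummable_reindex (fun x => nsq (u x)) (bij_mulg g)).
Qed.

Lemma nrm_translate (g : L) (u : L -> R[i]) : nrm (fun x => u (g * x)%g) = nrm u.
Proof. exact: (rsum_reindex (fun x => nsq (u x)) (bij_mulg g)). Qed.

Lemma l2_lreg (g : L) (u : L -> R[i]) : l2 u -> l2 (lreg g u).
Proof. exact: l2_translate. Qed.

(** Normalizing the squared modulus of an almost invariant vector gives an almost invariant
    probability density. In [3 * t], one [t] comes from the defect and two from the masses of [u]
    and of its translate. *)
Lemma almost_invariant_mass (g : L) (u : L -> R[i]) (t : R) :
  0 < t -> l2 u -> 0 < nrm u ->
  nrm (fun x => lreg g u x - u x) <= t ^+ 2 * nrm u ->
  rsum (fun x => `|nsq (u (g^-1 * x)%g) / nrm u - nsq (u x) / nrm u|) <= 3 * t.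
Proof.
move=> t0 lu u0 hu.
have /l2P su := lu; have /l2P sg := l2_lreg g lu.
have /l2P sd := l2B (l2_lreg g lu) lu.
have z1 := rsummableZ t^-1 sd; have z2 := rsummableZ t (rsummableD sg su).
have z3 := rsummable_norm (rsummableB sg su).
rewrite (@eq_rsum _ _ _ (fun x => (nrm u)^-1 * `|nsq (lreg g u x) - nsq (u x)|)).
  rewrite (rsumZ (nrm u)^-1 z3) ler_pdivrMl//.
  apply: (@le_trans _ _ (t^-1 * nrm (fun x => lreg g u x - u x) +
                         t * (nrm (lreg g u) + nrm u))).
    rewrite /nrm -(rsumD sg su) -(rsumZ _ sd) -(rsumZ _ (rsummableD sg su)).
    rewrite -(rsumD z1 z2).
    by apply: (le_rsum z3 (rsummableD z1 z2)) => x; exact: nsq_diff_le.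
  rewrite nrm_translate.
  have : t^-1 * nrm (fun x => lreg g u x - u x) <= t * nrm u.
    by rewrite ler_pdivrMl// mulrA -expr2.
  by lra.
move=> x; rewrite -mulrBl normrM mulrC; congr (_ * _).
by rewrite ger0_norm// invr_ge0 ltW.
Qed.

(** Without a gap there are vectors with relative squared defect below the square of 1 / (n + 1).
    The masses of their normalized squares move by at most 3 / (n + 1) under generators, so their
    ultralimit is an invariant mean. *)
Lemma spectral_gap (k : nat) (S : 'I_k -> L) : generates S -> ~ amenable L R ->
  exists2 c : R, 0 < c & forall u : L -> R[i], l2 u ->
    c * nrm u <= \sum_(j < k) nrm (fun x => lreg (S j) u x - u x).
Proof.
move=> genS nam; apply: contrapT => nogap; apply: nam.
have /choice[u uP] : forall n : nat, exists u : L -> R[i], l2 u /\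
    \sum_(j < k) nrm (fun x => lreg (S j) u x - u x) < n.+1%:R^-1 ^+ 2 * nrm u.
  move=> n; apply: contrapT => nu; apply: nogap.
  exists (n.+1%:R^-1 ^+ 2); first by rewrite exprn_gt0// invr_gt0.
  move=> u lu; rewrite leNgt; apply/negP => h; apply: nu; by exists u.
have lu n : l2 (u n) by case: (uP n).
have n0 n : 0 < (n.+1%:R^-1 : R) by rewrite invr_gt0.
have u0 n : 0 < nrm (u n).
  have [_] := uP n; rewrite -(pmulr_rgt0 (nrm (u n)) (exprn_gt0 2 (n0 n))).
  by apply: le_lt_trans; apply: sumr_ge0 => j _; exact: nrm_ge0.
pose p n x := nsq (u n x) / nrm (u n).
have p0 n x : 0 <= p n x by rewrite divr_ge0 ?nsq_ge0// ltW.
have spE n : rsummable (p n) /\ rsum (p n) = 1.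
  have /l2P su := lu n.
  have -> : p n = fun x => (nrm (u n))^-1 * nsq (u n x).
    by apply/funext => x; rewrite mulrC.
  split; first exact: (rsummableZ (nrm (u n))^-1 su).
  by rewrite (rsumZ _ su) mulVf// gt_eqF.
have sp n : rsummable (p n) by case: (spE n).
have p1 n : rsum (p n) = 1 by case: (spE n).
have [U [properU ooU] limU] := ultralimit R.
have /choice[m mP] : forall A, exists l : R, mass (p n) A @[n --> U] --> l.
  move=> A; apply: limU => n; rewrite mass_ge0//=.
  by rewrite -(p1 n) mass_le.
have uniq (a : nat -> R) (l l' : R) : a @ U --> l -> a @ U --> l' -> l = l'.
  by move=> al al'; rewrite -(cvg_lim (@Rhausdorff R) al) (cvg_lim (@Rhausdorff R) al').
exists m; split.
- by move=> A; apply: cvgr_to_ge (mP A) _; near=> n; exact: mass_ge0.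
- apply: uniq (mP setT) _; under eq_fun do rewrite massT p1.
  exact: cvg_cst.
- move=> A B AB; apply: uniq (mP _) _.
  under eq_fun do rewrite massU//.
  by apply: cvgD; exact: mP.
(* The elements preserving [m] form a subgroup, so invariance need only be checked on generators. *)
move=> g; pose H := [set g : L | forall A, m [set (g * x)%g | x in A] = m A].
suff : H g by [].
have HV x : H x -> H x^-1%g.
  move=> Hx A; rewrite -(Hx [set (x^-1 * y)%g | y in A]); congr m.
  rewrite image_comp; apply/seteqP; split=> y.
    by move=> [z Az <-] /=; rewrite mulgA mulgV mul1g.
  by move=> Ay; exists y => //=; rewrite mulgA mulgV mul1g.
rewrite (genS H)//.
- by move=> A; congr m; rewrite (_ : (fun x => _) = id) ?image_id//;
    apply/funext => x; rewrite mul1g.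
- move=> x y Hx Hy A; rewrite -(Hy A) -(Hx [set (y * z)%g | z in A]); congr m.
  by rewrite image_comp; apply: eq_imagel => z _ /=; rewrite mulgA.
(* [lreg (S j)] evaluates at [(S j)^-1 * x], so the estimate concerns translation by the inverse of
   the generator. *)
move=> j; rewrite -(invgK (S j)); apply: HV => A.
apply/eqP; rewrite -subr_eq0; apply/eqP; apply: uniq (cvgB (mP _) (mP _)) _.
apply/cvgrPdist_le => e e0; apply: ooU.
have [N NP] := natSinv_lt (divr_gt0 e0 (ltr0n R 3)).
exists N => // n /= /NP hn; rewrite sub0r normrN.
apply: le_trans (mass_translate _ _ (sp n) (p0 n)) _.
apply: (@le_trans _ _ (3 * n.+1%:R^-1)); last first.
  by move: hn; rewrite ltr_pdivlMr// mulrC => /ltW.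
apply: almost_invariant_mass => //; have [_ /ltW] := uP n.
apply: le_trans; rewrite (bigD1 j)//= lerDl.
by apply: sumr_ge0 => i _; exact: nrm_ge0.
Unshelve. all: by end_near.
Qed.

End Reiter.

Section Limits.
Context (R : realType) (I : choiceType).
Implicit Types (v : nat -> I -> R[i]) (u w x : I -> R[i]).

Lemma l2limD v v' w w' : (forall n, l2 (v n)) -> (forall n, l2 (v' n)) ->
  l2 w -> l2 w' -> l2lim v w -> l2lim v' w' ->
  l2lim (fun n i => v n i + v' n i) (fun i => w i + w' i).
Proof.
move=> lv lv' lw lw' vw vw' e e0.
have [N NP] := vw (e / 4) ltac:(lra); have [M MP] := vw' (e / 4) ltac:(lra).
exists (maxn N M) => n; rewrite geq_max => /andP[/NP h1 /MP h2].
have := nrmD_le (l2B (lv n) lw) (l2B (lv' n) lw').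
rewrite (@eq_nrm _ _ (fun i => v n i + v' n i - (w i + w' i))
  (fun i => (v n i - w i) + (v' n i - w' i))); last first.
  by move=> i; rewrite opprD addrACA.
by move: h1 h2; lra.
Qed.

Lemma l2limN v w : l2lim v w -> l2lim (fun n i => - v n i) (fun i => - w i).
Proof.
move=> vw e e0; have [N NP] := vw e e0; exists N => n /NP.
rewrite nrm_distC; congr (_ <= _); apply: eq_nrm => i.
by rewrite opprK addrC.
Qed.

Lemma l2lim_cst w : l2lim (fun=> w) w.
Proof.
move=> e e0; exists 0%N => n _; rewrite (_ : nrm _ = 0) ?ltW//.
by rewrite -(rsum0 R I); apply: eq_rsum => i; rewrite subrr nsq0.
Qed.

Lemma eq_l2lim v v' w w' : (forall n i, v n i = v' n i) -> (forall i, w i = w' i) ->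
  l2lim v w -> l2lim v' w'.
Proof.
move=> vv' ww' vw e e0; have [N NP] := vw e e0; exists N => n /NP.
by congr (_ <= _); apply: eq_nrm => i; rewrite vv' ww'.
Qed.

Lemma rdot_lim0 v w x : (forall n, l2 (v n)) -> l2 w -> l2 x -> l2lim v w ->
  (forall n, rdot (v n) x = 0) -> rdot w x = 0.
Proof.
move=> lv lw lx vw v0; apply/eqP; rewrite -normr_le0.
apply/ler_addgt0Pr => e e0; rewrite add0r.
have [N NP] := rdot_lim lv lw lx vw e0.
by have := NP N (leqnn N); rewrite v0 sub0r normrN.
Qed.

Lemma l2dot_eq0 u w : rdot u w = 0 -> rdot u (fun i => 'i * w i) = 0 ->
  l2dot u w = 0.
Proof.
move=> h1 h2; apply/eqP; rewrite eq_complex /=.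
by rewrite -[X in X == _]/(complex.Re (l2dot u w)) Re_l2dot h1 eqxx
  -[X in X == _]/(complex.Im (l2dot u w)) Im_l2dot h2 eqxx.
Qed.

Lemma l2_l2delta (i : I) : l2 (l2delta R i).
Proof.
apply/l2P.
have [] := @rsum1 R I (fun j => nsq (l2delta R i j)) i => // j ji.
by rewrite /l2delta eq_sym (negbTE ji) nsq0.
Qed.

Lemma rdot_l2delta (i : I) u : rdot (l2delta R i) u = complex.Re (u i).
Proof.
rewrite /rdot; set f := fun j => _; have [] := @rsum1 R I f i => [j ji|_ ->].
  by rewrite /f /l2delta eq_sym (negbTE ji) /= !mul0r addr0.
by rewrite /f /l2delta eqxx /= mul1r mul0r addr0.
Qed.

End Limits.

(** * Tuples of square-summable functions *)

Section Slices.
Context (R : realType) (L : choiceType) (k : nat).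
Implicit Types (c : L * 'I_k -> R[i]) (j : 'I_k).

Lemma l2_slice c j : l2 c ->
  l2 (fun x => c (x, j)) /\ nrm (fun x => c (x, j)) <= nrm c.
Proof.
move=> /l2P sc.
have [h1 h2] : rsummable (fun x => nsq (c (x, j))) /\
    rsum (fun x => nsq (c (x, j))) <= nrm c.
  apply: rsum_le => [x|s us]; first exact: nsq_ge0.
  rewrite -(big_map (fun x => (x, j)) predT (fun p => nsq (c p))).
  apply: fsum_le_rsum => //; first by move=> p; exact: nsq_ge0.
  by rewrite map_inj_uniq// => x y [].
by split => //; exact/l2P.
Qed.

Lemma l2_prod c : (forall j, l2 (fun x => c (x, j))) -> l2 c.
Proof.
move=> lc; apply/l2P.
have [] // := @rsum_le _ _ (fun p => nsq (c p)) (\sum_j nrm (fun x => c (x, j))).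
  by move=> p; exact: nsq_ge0.
move=> s us; rewrite (partition_big (fun p : L * 'I_k => p.2) predT)//=.
apply: ler_sum => j _; have /l2P sj := lc j.
have -> : \sum_(p <- s | p.2 == j) nsq (c p) =
    \sum_(x <- [seq p.1 | p <- s & p.2 == j]) nsq (c (x, j)).
  by rewrite big_map big_filter; apply: eq_bigr => -[x j'] /= /eqP->.
apply: fsum_le_rsum => //; first by move=> p; exact: nsq_ge0.
rewrite map_inj_in_uniq ?filter_uniq// => -[x i] [y i'].
by rewrite !mem_filter /= => /andP[/eqP-> _] /andP[/eqP-> _] ->.
Qed.

Lemma l2lim_slice (v : nat -> L * 'I_k -> R[i]) c j : (forall n, l2 (v n)) ->
  l2 c -> l2lim v c -> l2lim (fun n x => v n (x, j)) (fun x => c (x, j)).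
Proof.
move=> lv lc vc e e0; have [N NP] := vc e e0; exists N => n /NP.
by apply: le_trans; have [_] := l2_slice j (l2B (lv n) lc).
Qed.

End Slices.

(** * Vanishing of the first cohomology with l2 coefficients *)

Section Cohomology.
Context (R : realType) (L : groupType).
Implicit Types (b : L -> L -> R[i]) (u : L -> R[i]) (g h x : L).

Lemma l2lim_lreg g (v : nat -> L -> R[i]) u :
  l2lim v u -> l2lim (fun n => lreg g (v n)) (lreg g u).
Proof.
move=> vu e e0; have [N NP] := vu e e0; exists N => n /NP.
by rewrite -(nrm_translate g^-1%g).
Qed.

Lemma cocycle1 b x : l2cocycle b -> b 1%g x = 0.
Proof.
move=> [_ cb]; have := cb 1%g 1%g x; rewrite /lreg mulg1 invg1 mul1g => /eqP.
by rewrite -subr_eq subrr eq_sym => /eqP.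
Qed.

Lemma cocycleV b g x : l2cocycle b -> b g^-1%g x = - b g (g * x)%g.
Proof.
move=> bb; have [_ cb] := bb; have := cb g^-1%g g x.
by rewrite mulVg cocycle1// /lreg invgK => /esym/eqP; rewrite addr_eq0 => /eqP.
Qed.

Lemma coboundary_cocycle u : l2 u -> l2cocycle (fun g x => lreg g u x - u x).
Proof.
move=> lu; split=> [g|g h x]; first by apply: l2B => //; exact: l2_lreg.
by rewrite /lreg invgM -mulgA [RHS]addrC subrKA.
Qed.

Section GeneratingFamily.
Context (k : nat) (S : 'I_k -> L) (S_gen : generates S).
Implicit Types (c d : L * 'I_k -> R[i]).

Lemma l2Z1_l2 c : l2Z1 S c -> l2 c.
Proof.
move=> [b [lb _] cE]; apply: l2_prod => j.
by rewrite (_ : (fun x => _) = b (S j))//; apply/funext => x.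
Qed.

Lemma l2B1_Z1 c : l2B1 S c -> l2Z1 S c.
Proof.
move=> [u lu cE]; exists (fun g x => lreg g u x - u x) => //.
exact: coboundary_cocycle.
Qed.

Lemma l2B1_l2 c : l2B1 S c -> l2 c.
Proof. by move=> /l2B1_Z1/l2Z1_l2. Qed.

Lemma l2B1_0 : l2B1 (R := R) S (fun=> 0).
Proof. by exists (fun=> 0); [exact: l2_0|move=> x j; rewrite /lreg subrr]. Qed.

Lemma l2B1D c d : l2B1 S c -> l2B1 S d -> l2B1 S (fun i => c i + d i).
Proof.
move=> [u lu cE] [v lv dE]; exists (fun x => u x + v x); first exact: l2D.
by move=> x j; rewrite cE dE /lreg opprD addrACA.
Qed.

Lemma l2B1Z (z : R[i]) c : l2B1 S c -> l2B1 S (fun i => z * c i).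
Proof.
move=> [u lu cE]; exists (fun x => z * u x); first exact: l2Z.
by move=> x j; rewrite cE mulrBr.
Qed.

Lemma l2Z1D c d : l2Z1 S c -> l2Z1 S d -> l2Z1 S (fun i => c i + d i).
Proof.
move=> [b [lb bE] cE] [b' [lb' b'E] dE]; exists (fun g x => b g x + b' g x).
  split=> [g|g h x]; first exact: l2D.
  by rewrite bE b'E /lreg addrACA.
by move=> x j; rewrite cE dE.
Qed.

Lemma l2Z1Z (z : R[i]) c : l2Z1 S c -> l2Z1 S (fun i => z * c i).
Proof.
move=> [b [lb bE] cE]; exists (fun g x => z * b g x).
  split=> [g|g h x]; first exact: l2Z.
  by rewrite bE /lreg mulrDr.
by move=> x j; rewrite cE.
Qed.

Lemma l2H1P c : l2H1 S c <->
  l2Z1 S c /\ forall d, l2B1 S d -> rdot c d = 0.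
Proof.
split=> -[Zc h]; split=> // d Bd; first by rewrite -Re_l2dot h.
by apply: l2dot_eq0; apply: h => //; exact: l2B1Z.
Qed.

(** Convergence on generators propagates by the cocycle identity: the elements at which the cocycles
    converge form a subgroup. The limits then satisfy the identity by uniqueness. *)
Lemma l2Z1_closed : l2closed (l2Z1 (R := R) S).
Proof.
move=> c w Zc lw cw.
have /choice[b bP] : forall n, exists b, l2cocycle b /\
    forall x j, c n (x, j) = b (S j) x.
  by move=> n; have [b ? ?] := Zc n; exists b.
have bb n : l2cocycle (b n) by case: (bP n).
have bE n x j : c n (x, j) = b n (S j) x by case: (bP n).
have lb n g : l2 (b n g) by case: (bb n).
have lc n : l2 (c n) by exact: l2Z1_l2.
pose H := [set g : L | exists2 u, l2 u & l2lim (fun n => b n g) u].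
have HT : H = setT.
  apply: S_gen.
  - exists (fun=> 0); first exact: l2_0.
    by apply: eq_l2lim (l2lim_cst (fun=> 0)) => // n x; rewrite cocycle1.
  - move=> g h [u lu gu] [v lv hv]; exists (fun x => u x + lreg g v x).
      by apply: l2D => //; exact: l2_lreg.
    have := l2limD (fun n => lb n g) (fun n => l2_lreg g (lb n h)) lu (l2_lreg g lv)
      gu (l2lim_lreg g hv).
    by apply: eq_l2lim => // n x; have [_ ->] := bb n.
  - move=> g [u lu gu]; exists (fun x => - lreg g^-1%g u x).
      by apply: l2N; exact: l2_lreg.
    apply: eq_l2lim (l2limN (l2lim_lreg g^-1%g gu)) => // n x.
    by rewrite cocycleV// /lreg invgK.
  - move=> j; exists (fun x => w (x, j)); first by have [] := l2_slice j lw.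
    by apply: eq_l2lim (l2lim_slice j lc lw cw) => // n x.
have /choice[B BP] : forall g, exists u, l2 u /\ l2lim (fun n => b n g) u.
  by move=> g; have [u ? ?] : H g by [rewrite HT]; exists u.
have lB g : l2 (B g) by case: (BP g).
have limB g : l2lim (fun n => b n g) (B g) by case: (BP g).
exists B.
  split=> // g h x.
  apply: (@l2lim_unique R L (fun n => b n (g * h)%g) _
    (fun x => B g x + lreg g (B h) x)) => //.
    by apply: l2D => //; exact: l2_lreg.
  have := l2limD (fun n => lb n g) (fun n => l2_lreg g (lb n h)) (lB g)
    (l2_lreg g (lB h)) (limB g) (l2lim_lreg g (limB h)).
  by apply: eq_l2lim => // n y; have [_ ->] := bb n.
move=> x j.
apply: (@l2lim_unique R L (fun n => b n (S j)) (fun x => w (x, j)) (B (S j))) => //.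
  by have [] := l2_slice j lw.
by apply: eq_l2lim (l2lim_slice j lc lw cw) => // n y.
Qed.

Lemma l2H1_closed : l2closed (l2H1 (R := R) S).
Proof.
move=> c w Hc lw cw; apply/l2H1P; split.
  by apply: l2Z1_closed lw cw => n; have [] := Hc n.
move=> d Bd; apply: (@rdot_lim0 _ _ c w) => //.
- by move=> n; apply: l2Z1_l2; case: (Hc n).
- exact: l2B1_l2.
- by move=> n; have /l2H1P[_] := Hc n; apply.
Qed.

Lemma l2H1_0 : l2H1 (R := R) S (fun=> 0).
Proof.
apply/l2H1P; split; first exact/l2B1_Z1/l2B1_0.
by move=> d _; rewrite -(rsum0 R (L * 'I_k)%type); apply: eq_rsum => i; rewrite !mul0r addr0.
Qed.

Lemma l2H1D c d : l2H1 S c -> l2H1 S d -> l2H1 S (fun i => c i + d i).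
Proof.
move=> /l2H1P[Zc hc] /l2H1P[Zd hd]; apply/l2H1P; split; first exact: l2Z1D.
move=> e Be; rewrite rdotDl ?hc ?hd ?addr0//; do ?exact: l2Z1_l2.
exact: l2B1_l2.
Qed.

Lemma l2H1Z (z : R[i]) c : l2H1 S c -> l2H1 S (fun i => z * c i).
Proof.
move=> /l2H1P[Zc hc]; apply/l2H1P; split; first exact: l2Z1Z.
by move=> d Bd; rewrite rdotZl hc//; exact: l2B1Z.
Qed.

(** Right translations commute with [lreg], hence preserve cocycles and coboundaries, and they
    preserve the inner product. *)
Lemma l2H1_translate h c : l2H1 S c -> l2H1 S (fun i => c ((i.1 * h)%g, i.2)).
Proof.
move=> /l2H1P[[b [lb bE] cE] hc].
have bij_mulgr g : bijective (fun x => x * g)%g.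
  by exists (fun x => x * g^-1)%g => x; [rewrite mulgK|rewrite -mulgA mulVg mulg1].
have l2r g u : l2 u -> l2 (fun x => u (x * g)%g).
  move=> /l2P su; apply/l2P.
  exact/(rsummable_reindex (fun x => nsq (u x)) (bij_mulgr g)).
apply/l2H1P; split.
  exists (fun g x => b g (x * h)%g); last by move=> x j /=; rewrite cE.
  split=> [g|g g' x]; first exact: l2r.
  by rewrite bE /lreg mulgA.
move=> d [u lu dE].
rewrite -[RHS](hc (fun i => d ((i.1 * h^-1)%g, i.2))); last first.
  by exists (fun x => u (x * h^-1)%g); [exact: l2r|move=> x j; rewrite /= dE /lreg mulgA].
rewrite /rdot.
have bij2 : bijective (fun i : L * 'I_k => ((i.1 * h)%g, i.2)).
  by exists (fun i => ((i.1 * h^-1)%g, i.2)) => -[x j] /=;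
    [rewrite mulgK|rewrite -mulgA mulVg mulg1].
rewrite -[RHS](rsum_reindex _ bij2); apply: eq_rsum => -[x j] /=.
by rewrite mulgK.
Qed.

(** Faithfulness of the trace: each summand is the squared norm of a projected delta function, so
    all these projections vanish. Members of the space are then orthogonal to the deltas at the
    identity, and right translation reaches the other points. *)
Lemma l2H1_eq0 : l2betti1 R S = 0 -> forall c, l2H1 S c -> forall i, c i = 0.
Proof.
move=> betti0.
have projP (j : 'I_k) : let p := orth_proj (l2H1 S) (l2delta R (1%g, j)) in
    l2H1 S p /\ forall v, l2H1 S v ->
      l2dot (fun i => l2delta R (1%g, j) i - p i) v = 0.
  pose P := [set p | l2H1 S p /\ forall v, l2H1 S v ->
      l2dot (fun i => l2delta R (1%g, j) i - p i) v = 0].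
  have [||||||p Hp pP] := @real_projection R (L * 'I_k)%type (l2H1 S)
      (l2delta R (1%g, j)).
  - by move=> c [Zc _]; exact: l2Z1_l2.
  - exact: l2H1_0.
  - by move=> c d; exact: l2H1D.
  - by move=> t c; exact: l2H1Z.
  - exact: l2H1_closed.
  - exact: l2_l2delta.
  (* The projection exists, so [orth_proj] satisfies its specification and is not merely the default
     value. *)
  apply: (@xgetPex _ (fun=> 0) P); exists p; split=> // v Hv.
  by apply: l2dot_eq0; apply: pP => //; exact: l2H1Z.
have p_eq0 (j : 'I_k) i : orth_proj (l2H1 S) (l2delta R (1%g, j)) i = 0.
  set p := fun j => orth_proj (l2H1 S) (l2delta R (1%g, j)).
  have lp i' : l2 (p i') by have [[Zp _] _] := projP i'; exact: l2Z1_l2.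
  have dotE i' : complex.Re (l2dot (p i') (l2delta R (1%g, i'))) = nrm (p i').
    have [Hp hp] := projP i'.
    have : rdot (fun i => l2delta R (1%g, i') i - p i' i) (p i') = 0.
      by rewrite -Re_l2dot hp.
    rewrite rdotBl//; last exact: l2_l2delta.
    by rewrite rdotxx Re_l2dot rdotC => /eqP; rewrite subr_eq0 => /eqP.
  have : \sum_(j < k) nrm (p j) = 0.
    by rewrite -[RHS]betti0 /l2betti1 /vn_dim; apply: eq_bigr => i' _; rewrite -dotE.
  move/eqP; rewrite psumr_eq0 => [/allP/(_ j)|i' _]; last exact: nrm_ge0.
  rewrite mem_index_enum => /(_ isT)/= /eqP p0.
  exact: (nrm_eq0 (lp j) p0).
move=> c Hc [x j].
pose d := fun i : L * 'I_k => c ((i.1 * x)%g, i.2).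
have Hd : l2H1 S d by exact: l2H1_translate.
have [_ hp] := projP j; have h := hp _ Hd.
have E v : rdot (fun i => l2delta R (1%g, j) i -
    orth_proj (l2H1 S) (l2delta R (1%g, j)) i) v = complex.Re (v (1%g, j)).
  by rewrite -rdot_l2delta; apply: eq_rsum => i; rewrite p_eq0 subr0.
have := congr1 (@complex.Re R) h; rewrite Re_l2dot E /d /= mul1g => re0.
have := congr1 (@complex.Im R) h; rewrite Im_l2dot E /d /= mul1g -complexiE.
by case: (c (x, j)) re0 => a b /= ->; simpc => /= /eqP; rewrite oppr_eq0 => /eqP->.
Qed.

(** The gap bounds [u] by its coboundary, so convergence of coboundaries forces convergence of the
    vectors they come from. *)
Lemma l2B1_closed (e : R) : 0 < e ->
  (forall u : L -> R[i], l2 u ->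
     e * nrm u <= \sum_(j < k) nrm (fun x => lreg (S j) u x - u x)) ->
  l2closed (l2B1 (R := R) S).
Proof.
move=> e0 gap c w Bc lw cw.
have /choice[u uP] : forall n, exists u, l2 u /\
    forall x j, c n (x, j) = lreg (S j) u x - u x.
  by move=> n; have [u ? ?] := Bc n; exists u.
have lu n : l2 (u n) by case: (uP n).
have uE n x j : c n (x, j) = lreg (S j) (u n) x - u n x by case: (uP n).
have lc n : l2 (c n) by exact: l2B1_l2.
have cu : l2cauchy u.
  move=> r r0; have K0 : 0 < k.+1%:R :> R by rewrite ltr0n.
  (* The budget [e * r] is shared among [k] generators; the denominator [k.+1] also covers
     [k = 0]. *)
  have [N NP] := l2lim_cauchy lc lw cw (divr_gt0 (mulr_gt0 e0 r0) K0).
  exists N => m n Nm Nn; rewrite -(ler_pM2l e0).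
  apply: le_trans (gap _ (l2B (lu m) (lu n))) _.
  apply: (@le_trans _ _ (\sum_(j < k) (e * r / k.+1%:R))).
    apply: ler_sum => j _; apply: le_trans (NP m n Nm Nn).
    have [_] := l2_slice j (l2B (lc m) (lc n)); apply: le_trans.
    rewrite le_eqVlt; apply/orP; left; apply/eqP; apply: eq_nrm => x.
    by rewrite !uE /lreg !opprB addrACA [RHS]addrACA; congr (_ + _); rewrite addrC.
  rewrite sumr_const card_ord -[leLHS]mulr_natr [leLHS]mulrAC ler_pdivrMr// ler_wpM2l//.
    by rewrite mulr_ge0 ?ltW.
  by rewrite ler_nat.
have [v lv uv] := l2_complete lu cu; exists v => // x j.
apply: (@l2lim_unique R L (fun n x => c n (x, j)) (fun x => w (x, j))
  (fun x => lreg (S j) v x - v x)).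
- by move=> n; have [] := l2_slice j (lc n).
- by have [] := l2_slice j lw.
- by apply: l2B => //; exact: l2_lreg.
- exact: l2lim_slice.
have := l2limD (fun n => l2_lreg (S j) (lu n)) (fun n => l2N (lu n))
  (l2_lreg (S j) lv) (l2N lv) (l2lim_lreg (S j) uv) (l2limN uv).
by apply: eq_l2lim => // n y.
Qed.

(* Nonamenability makes B1 closed, so that ordinary and reduced cohomology
   agree; the latter vanishes since the trace on the von Neumann algebra is
   faithful. *)
Lemma cocycle_coboundary b : ~ amenable L R -> l2betti1 R S = 0 ->
  l2cocycle b -> exists2 u, l2 u & forall g x, b g x = lreg g u x - u x.
Proof.
move=> nam betti0 bb.
have [e e0 gap] := spectral_gap S_gen nam.
pose c i := b (S i.2) i.1.
have Zc : l2Z1 S c by exists b.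
have [||||||p Bp pP] := @real_projection R (L * 'I_k)%type (l2B1 S) c.
- exact: l2B1_l2.
- exact: l2B1_0.
- exact: l2B1D.
- by move=> t d; exact: l2B1Z.
- exact: l2B1_closed gap.
- exact: l2Z1_l2.
have Hr : l2H1 S (fun i => c i - p i).
  apply/l2H1P; split=> //.
  have := l2Z1D Zc (l2B1_Z1 (l2B1Z (-1) Bp)).
  by rewrite (_ : (fun i => c i + -1 * p i) = fun i => c i - p i)//;
    apply/funext => i; rewrite mulN1r.
have [u lu uE] := Bp.
have cE x j : b (S j) x = lreg (S j) u x - u x.
  by rewrite -uE; apply/eqP; rewrite -subr_eq0 (l2H1_eq0 betti0 Hr (x, j)).
exists u => // g x.
pose H := [set g | forall x, b g x = lreg g u x - u x].
have uu := coboundary_cocycle lu.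
suff HT : H = setT by have : H g by [rewrite HT]; exact.
apply: S_gen.
- by move=> y; rewrite cocycle1// (cocycle1 _ uu).
- move=> g1 g2 h1 h2 y; have [_ ->] := bb; have [_ ->] := uu.
  by rewrite h1 /lreg h2.
- by move=> g1 h1 y; rewrite cocycleV// (cocycleV _ _ uu) h1.
- by move=> j y.
Qed.

End GeneratingFamily.
End Cohomology.

Lemma finite_lower_bound (R : realType) (T : choiceType) (f : T -> R) (E : set T) :
  finite_set E -> (forall x, 0 < f x) ->
  exists2 e : R, 0 < e & forall x, E x -> e <= f x.
Proof.
move=> /finite_seqP[s ->] f0; elim: s => [|x s [e e0 eP]]; first by exists 1.
exists (Num.min e (f x)); first by rewrite lt_min e0 f0.
move=> y /=; rewrite inE ge_min => /orP[/eqP->|ys]; first by rewrite lexx orbT.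
by rewrite eP.
Qed.

(** * Positive summable functions under translation *)

Section Dynamics.
Context (R : realType) (L : groupType).
Implicit Types (f : L -> R) (g x : L).

(** A function nondecreasing along [g] with the same finite sum as its translate is invariant.
    Truncation makes [f] nondecreasing everywhere, yet far away, where [f] is small, the growth is
    strict. *)
Lemma no_contraction f g (q : R) : infinite_set [set: L] ->
  rsummable f -> (forall x, 0 < f x) -> 0 < q < 1 ->
  finite_set [set x | ~ (f x <= q * f (g * x)%g)] -> False.
Proof.
move=> infL sf f0 /andP[q0 q1] finE; set E := [set x | _] in finE.
have f_gt0 x : 0 <= f x by exact: ltW.
have [e1 e1_gt0 e1P] := finite_lower_bound finE f0.
have [e2 e2_gt0 e2P] := @finite_lower_bound R L (fun x => f (g * x)%g) E finE (fun x => f0 _).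
have [e e0 eE] : exists2 e : R, 0 < e & forall x, E x -> e <= f x /\ e <= f (g * x)%g.
  exists (Num.min e1 e2) => [|x Ex]; first by rewrite lt_min e1_gt0.
  by rewrite !ge_min e1P// e2P// orbT.
(* The level [e] lies below [f] on the exceptional set and on its translate, where [h] is therefore
   constant. *)
pose h x := Num.min (f x) e.
have h0 x : 0 <= h x by rewrite le_min f_gt0 ltW.
have sh : rsummable h.
  by apply: rsummable_le sf => x; rewrite ger0_norm// ge_min lexx.
have shg : rsummable (fun x => h (g * x)%g).
  exact/(rsummable_reindex _ (bij_mulg g)).
have hle x : h x <= h (g * x)%g.
  have [/eE[e1' e2']|nEx] := pselect (E x).
    by rewrite /h (min_idPr e1') (min_idPr e2').
  rewrite /h le_min !ge_min lexx orbT andbT; apply/orP; left.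
  have {nEx} : f x <= q * f (g * x)%g by apply: contrapT.
  by have := f_gt0 (g * x)%g; nra.
have hE x : h (g * x)%g = h x.
  apply/eqP; rewrite -subr_eq0; apply/eqP.
  apply: (rsum_eq0 (rsummableB shg sh)) => [y|]; first by rewrite subr_ge0.
  by rewrite (rsumB shg sh) (rsum_reindex h (bij_mulg g)) subrr.
have finF : finite_set [set x | q * e <= `|f x|].
  by apply: rsummable_finite => //; rewrite mulr_gt0.
(* At such a point [f x0 < q * e]: the truncation does not act at [x0], and [h] strictly increases
   from [x0] to [g * x0]. *)
have [x0 x0P] : exists x, ~ (E `|` [set x | q * e <= `|f x|]) x.
  apply: contrapT => nex; apply: infL.
  apply: (sub_finite_set _ (_ : finite_set (E `|` [set x | q * e <= `|f x|]))).
    by move=> x _; apply: contrapT => nx; apply: nex; exists x.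
  by rewrite finite_setU.
have fx : f x0 < q * e.
  rewrite ltNge; apply/negP => h1; apply: x0P; right => /=.
  by rewrite ger0_norm.
have fx' : f x0 <= q * f (g * x0)%g by apply: contrapT => nE; apply: x0P; left.
have := hE x0; rewrite /h.
have := f0 x0; have := f0 (g * x0)%g.
case: (lerP (f x0) e) => h1; case: (lerP (f (g * x0)%g) e) => h2; nra.
Qed.

(** On a finite group the constant function 1 would be a nonzero invariant vector. *)
Lemma infinite_group k (S : 'I_k -> L) (c : R) : 0 < c ->
  (forall u : L -> R[i], l2 u ->
    c * nrm u <= \sum_(j < k) nrm (fun x => lreg (S j) u x - u x)) ->
  infinite_set [set: L].
Proof.
move=> c0 gap /finite_seqP[s sE].
have lu : l2 (fun _ : L => 1 : R[i]).
  apply/l2P.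
  have [] // := @rsum_le R L (fun=> nsq (1 : R[i])) (nsq (1 : R[i]) *+ size s).
    by move=> _; exact: nsq_ge0.
  move=> r ur; rewrite big_const_seq count_predT iter_addr_0 ler_wpMn2l ?nsq_ge0//.
  apply: uniq_leq_size => // x _.
  by have : [set: L] x by []; rewrite sE.
have := gap _ lu; rewrite big1 => [|j _].
  rewrite pmulr_rle0// leNgt => /negP; apply; apply: lt_le_trans (nsq_le_nrm 1%g lu).
  by rewrite /nsq /= expr1n expr0n addr0.
by rewrite -(rsum0 R L); apply: eq_rsum => x; rewrite /lreg subrr nsq0.
Qed.

Lemma dist_min_le (p q e d : R) : 0 < p -> 0 < q -> 0 < e -> 0 < d -> `|p - q| <= d * q ->
  `|Num.min p e - Num.min q e| <= d * Num.min q e.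
Proof.
move=> p0 q0 e0 d0; rewrite !ler_norml => /andP[h1 h2].
by case: (lerP p e) => h3; case: (lerP q e) => h4; apply/andP; split; nra.
Qed.

(** The truncation of [f] has relative defect [d] at every point, including the exceptional ones, so
    its total squared defect is at most [k * d ^+ 2] times its squared norm, below the gap. *)
Lemma not_almost_invariant k (S : 'I_k -> L) (c : R) f : 0 < c ->
  (forall u : L -> R[i], l2 u ->
    c * nrm u <= \sum_(j < k) nrm (fun x => lreg (S j) u x - u x)) ->
  rsummable (fun x => f x ^+ 2) -> (forall x, 0 < f x) ->
  ~ (forall j (d : R), 0 < d ->
      finite_set [set x | ~ (`|f ((S j)^-1 * x)%g - f x| <= d * f x)]).
Proof.
move=> c0 gap sf f0 inv.
have K1 : 1 <= k.+1%:R :> R by rewrite ler1n.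
have [d d0 dP] : exists2 d : R, 0 < d & k%:R * d ^+ 2 < c.
  exists (c / (k.+1%:R * (1 + c))); first by rewrite divr_gt0 ?mulr_gt0; lra.
  have kK : k%:R < k.+1%:R :> R by rewrite ltr_nat.
  move: kK K1; move: (k.+1%:R : R) (k%:R : R) (ler0n R k) => K k' k'0 kK K1.
  set d := c / _; have dE : d * (K * (1 + c)) = c by rewrite divfK// gt_eqF// mulr_gt0; lra.
  have d0 : 0 < d by rewrite divr_gt0 ?mulr_gt0; lra.
  have dK0 : 0 < d * K by rewrite mulr_gt0; lra.
  have dKc0 : 0 < d * K * c by rewrite mulr_gt0.
  have h1 : d * K < c by lra.
  have h2 : d < 1.
    rewrite ltNge; apply/negP => d1; have dK1 : 1 <= d * K by nra.
    have dKc : c <= d * K * c by nra.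
    by lra.
  have h3 : k' * d <= d * K by nra.
  by rewrite expr2; nra.
pose E j := [set x | ~ (`|f ((S j)^-1 * x)%g - f x| <= d * f x)].
(* Both [x] and [(S j)^-1 * x] must lie above the truncation level, hence the translates of the
   exceptional sets. *)
pose F := \bigcup_(j in [set: 'I_k]) (E j `|` [set ((S j)^-1 * x)%g | x in E j]).
have finF : finite_set F.
  apply: bigcup_finite => [|j _]; first exact: finite_finset.
  by rewrite finite_setU; split; [exact: inv|apply: finite_image; exact: inv].
have [e e0 eP] := finite_lower_bound finF f0.
pose h x := Num.min (f x) e.
have h0 x : 0 < h x by rewrite lt_min f0.
have sh : rsummable (fun x => h x ^+ 2).
  apply: rsummable_le sf => x; rewrite ger0_norm ?sqr_ge0//.
  by apply: lerXn2r; rewrite ?nnegrE ?(ltW (h0 x)) ?(ltW (f0 x))// /h ge_min lexx.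
have nsqr (r : R) : nsq r%:C = r ^+ 2 by rewrite /nsq /= expr0n addr0.
pose u x := (h x)%:C.
have lu : l2 u by apply: l2_le sh => x; rewrite nsqr.
have hj j x : `|h ((S j)^-1 * x)%g - h x| <= d * h x.
  have [Ex|nEx] := pselect (E j x); last by apply: dist_min_le => //; apply: contrapT.
  have e1 : e <= f x by apply: eP; exists j => //; left.
  have e2 : e <= f ((S j)^-1 * x)%g by apply: eP; exists j => //; right; exists x.
  by rewrite /h (min_idPr e1) (min_idPr e2) subrr normr0 mulr_ge0 ?ltW.
have nu0 : 0 < nrm u.
  by apply: lt_le_trans (nsq_le_nrm 1%g lu); rewrite nsqr exprn_gt0.
have := gap u lu; rewrite leNgt => /negP; apply.
apply: (@le_lt_trans _ _ (\sum_(j < k) d ^+ 2 * nrm u)).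
  apply: ler_sum => j _; have /l2P su := lu.
  have /l2P sd := l2B (l2_lreg (S j) lu) lu.
  rewrite /nrm -(rsumZ _ su).
  apply: (le_rsum sd (rsummableZ (d ^+ 2) su)) => x.
  rewrite /lreg /u -rmorphB /= !nsqr -exprMn -[leLHS]real_normK ?num_real//.
  by apply: lerXn2r; rewrite ?nnegrE ?mulr_ge0 ?(ltW (h0 _)) ?(ltW d0) ?normr_ge0//.
by rewrite sumr_const card_ord -mulr_natl mulrA ltr_pM2r.
Qed.

End Dynamics.

(** * The invariant form and the corner entry *)

Section Form.
Context (R : realType) (n : nat).

Lemma nsq1 : nsq (1 : R[i]) = 1.
Proof. by rewrite /nsq /= expr1n expr0n addr0. Qed.

Lemma nsqV (z : R[i]) : nsq z^-1 = (nsq z)^-1.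
Proof.
have [->|z0] := eqVneq z 0; first by rewrite invr0 nsq0 invr0.
have n0 : nsq z != 0 by apply: contra_neq z0 => /nsq_eq0.
by apply: (mulfI n0); rewrite -nsqM !divff// nsq1.
Qed.

Lemma hformE (z : 'cV[R[i]]_n.+1) : hform z =
  \sum_(i < n.+1 | i != ord_max) nsq (z i ord0) - nsq (z ord_max ord0).
Proof. by rewrite /hform nsqE; congr (_ - _); apply: eq_bigr => i _; rewrite nsqE. Qed.

Lemma mul_origin (F : pzRingType) (A : 'M[F]_n.+1) i :
  (A *m origin F n) i ord0 = A i ord_max.
Proof. by rewrite /origin -colE mxE. Qed.

Lemma hform_origin : hform (origin R[i] n) = -1.
Proof.
rewrite hformE mxE !eqxx nsq1 big1 ?sub0r// => i im.
by rewrite mxE (negbTE im) nsq0.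
Qed.

(** The last column is the image of the origin, on which the form takes the value -1. *)
Lemma sum_nsq_col (A : 'M[R[i]]_n.+1) : (forall z, hform (A *m z) = hform z) ->
  \sum_(i < n.+1 | i != ord_max) nsq (A i ord_max) = nsq (A ord_max ord_max) - 1.
Proof.
move=> Ah; have := Ah (origin R[i] n); rewrite hform_origin hformE mul_origin.
by under eq_bigr do rewrite mul_origin; lra.
Qed.

Lemma nsq_corner_ge1 (A : 'M[R[i]]_n.+1) : (forall z, hform (A *m z) = hform z) ->
  1 <= nsq (A ord_max ord_max).
Proof.
move=> Ah; rewrite -subr_ge0 -sum_nsq_col//.
by apply: sumr_ge0 => i _; exact: nsq_ge0.
Qed.

Lemma l2_sum (I : choiceType) (J : finType) (F : J -> I -> R[i]) :
  (forall j, l2 (F j)) -> l2 (fun x => \sum_j F j x).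
Proof.
move=> lF; elim: (index_enum J) => [|j s IHs].
  by rewrite (_ : (fun x => _) = fun=> 0);
    [exact: l2_0|apply/funext => x; rewrite big_nil].
rewrite (_ : (fun x => _) = fun x => F j x + \sum_(i <- s) F i x).
  exact: l2D.
by apply/funext => x; rewrite big_cons.
Qed.

Lemma dist_sqrt_le (p q d : R) : 0 < p -> 0 < q -> `|p - q| <= d * q ->
  `|Num.sqrt p - Num.sqrt q| <= d * Num.sqrt q.
Proof.
move=> p0 q0 h.
have := sqr_sqrtr (ltW p0); have := sqr_sqrtr (ltW q0).
have : 0 < Num.sqrt p by rewrite sqrtr_gt0.
have : 0 < Num.sqrt q by rewrite sqrtr_gt0.
move: (Num.sqrt p) (Num.sqrt q) => a b b0 a0 bE aE; move: h; rewrite -bE -aE.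
rewrite subr_sqr normrM (gtr0_norm (addr_gt0 a0 b0)) expr2 mulrA => h.
have : `|a - b| * b <= d * b * b.
  by apply: le_trans h; rewrite ler_wpM2l// lerDr ltW.
by rewrite ler_pM2r.
Qed.

End Form.

(** * The orbit of the origin and the contradiction *)

Section Representation.
Context (R : realType) (L : groupType) (n : nat) (phi : L -> 'M[R[i]]_n.+1).
Hypothesis phiM : forall g h, phi (g * h)%g = phi g *m phi h.
Hypothesis phi_hform : forall g z, hform (phi g *m z) = hform z.

(** The square of the a(g) of the overview. *)
Let A g := nsq (phi g ord_max ord_max).

(* Coordinate of the orbit point of the origin in the ball model. *)
Let ballc i g := phi g i ord_max / phi g ord_max ord_max.

Let A_ge1 g : 1 <= A g.
Proof. exact: nsq_corner_ge1. Qed.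

Let corner_neq0 g : phi g ord_max ord_max != 0.
Proof. by apply/eqP => g0; have := A_ge1 g; rewrite /A g0 nsq0; lra. Qed.

(* The difference of two orbit points of the ball is the image under phi y of a
   vector whose component orthogonal to the origin has squared norm at most
   A g / A (y * g). *)
Lemma ballc_diff i y g :
  nsq (ballc i (y * g)%g - ballc i y) <= A g * (A (y * g)%g)^-1.
Proof.
have [->|im] := eqVneq i ord_max.
  by rewrite /ballc !divff// subrr nsq0 mulr_ge0 ?invr_ge0 ?nsq_ge0.
pose alpha := phi y ord_max ord_max; pose beta := phi (y * g)%g ord_max ord_max.
pose z := beta^-1 *: (phi g *m origin R[i] n) - alpha^-1 *: origin R[i] n.
have zE j : (phi y *m z) j ord0 = ballc j (y * g)%g - ballc j y.
  rewrite mulmxBr -!scalemxAr mulmxA -phiM.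
  have -> (u v : 'cV[R[i]]_n.+1) : (beta^-1 *: u - alpha^-1 *: v) j ord0 =
      u j ord0 / beta - v j ord0 / alpha by rewrite !mxE ![_^-1 * _]mulrC.
  by rewrite !mul_origin.
have ballc_max h : ballc ord_max h = 1 by rewrite /ballc divff.
apply: (@le_trans _ _ (hform (phi y *m z))).
  rewrite hformE !zE !ballc_max subrr nsq0 subr0.
  rewrite (bigD1 i)//= zE lerDl.
  by apply: sumr_ge0 => j _; exact: nsq_ge0.
rewrite phi_hform hformE.
apply: (@le_trans _ _ (\sum_(j < n.+1 | j != ord_max) nsq (beta^-1 * phi g j ord_max))).
  rewrite lerBlDr -[leLHS]addr0 lerD ?nsq_ge0// le_eqVlt; apply/orP; left.
  apply/eqP; apply: eq_bigr => j jm; congr nsq.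
  have -> (u v : 'cV[R[i]]_n.+1) : (beta^-1 *: u - alpha^-1 *: v) j ord0 =
      beta^-1 * u j ord0 - alpha^-1 * v j ord0 by rewrite !mxE.
  by rewrite mul_origin !mxE (negbTE jm) mulr0 subr0.
under eq_bigr do rewrite nsqM nsqV.
rewrite -mulr_sumr sum_nsq_col// mulrC ler_wpM2r ?invr_ge0 ?nsq_ge0//.
by rewrite lerBlDr lerDl.
Qed.

Context (k : nat) (S : 'I_k -> L).
Hypothesis S_gen : generates S.
Hypothesis L_nonamenable : ~ amenable L R.
Hypothesis L_betti1 : l2betti1 R S = 0.
Hypothesis sA : rsummable (fun g => (A g)^-1).

(** If [b] is the coboundary of [u], evaluation at the identity reads
    [ballc i g - ballc i 1 = u g^-1 - u 1], which identifies [xi]. *)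
Lemma ballc_cvg i : exists xi : R[i], l2 (fun g => ballc i g - xi).
Proof.
pose b g x := ballc i (x^-1 * g)%g - ballc i x^-1%g.
have bb : l2cocycle b.
  split=> [g|g h x]; last first.
    by rewrite /b /lreg invgM invgK mulgA [RHS]addrC subrKA.
  have bij : bijective (fun x : L => x^-1 * g)%g.
    exists (fun y => g * y^-1)%g => x; first by rewrite invgM invgK mulgA mulgV mul1g.
    by rewrite invgM invgK -mulgA mulVg mulg1.
  have := rsummableZ (A g) ((rsummable_reindex (fun g => (A g)^-1) bij).2 sA).
  by apply: l2_le => x; exact: ballc_diff.
have [u lu uE] := cocycle_coboundary S_gen L_nonamenable L_betti1 bb.
exists (ballc i 1%g - u 1%g).
have bijV : bijective (@monoid.inv L) by exists (@monoid.inv L) => x; exact: invgK.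
have /l2P su := lu; apply: l2_le ((rsummable_reindex _ bijV).2 su) => g.
have := uE g 1%g; rewrite /b /lreg invg1 mul1g mulg1 => h.
by rewrite opprB addrCA h addrCA subrr addr0.
Qed.

Let infL : infinite_set [set: L].
Proof. by have [e e0 gap] := spectral_gap S_gen L_nonamenable; exact: infinite_group gap. Qed.

Lemma finite_far (z : R[i]) (w : L -> R[i]) (e : R) : l2 w -> 0 < e ->
  finite_set [set x | ~ (`|nsq (z + w x) - nsq z| <= e)].
Proof.
move=> /l2P sw e0.
(* [M] bounds [nsq (z + w x) + nsq z] once [nsq (w x) < 1]; then [t] and the threshold [t * e / 2]
   make each half of [nsq_diff_le] at most [e / 2]. *)
pose M := 3 * nsq z + 2; have M0 : 0 < M by rewrite /M; have := nsq_ge0 z; lra.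
pose t := e / (2 * M); have t0 : 0 < t by rewrite divr_gt0 ?mulr_gt0.
have r0 : 0 < Num.min 1 (t * e / 2).
  by rewrite lt_min ltr01 /=; apply: divr_gt0 => //; exact: mulr_gt0.
apply: sub_finite_set (rsummable_finite sw r0) => x /= far.
rewrite leNgt; apply/negP; rewrite ger0_norm ?nsq_ge0// lt_min => /andP[w1 w2].
apply: far.
apply: le_trans (nsq_diff_le _ _ t0) _; rewrite addrAC subrr add0r.
have h1 : t^-1 * nsq (w x) <= e / 2 by rewrite ler_pdivrMl//; lra.
have h2 : t * (nsq (z + w x) + nsq z) <= e / 2.
  have -> : e / 2 = t * M by rewrite /t; field; rewrite gt_eqF.
  by rewrite ler_pM2l// /M; have := nsqD_le z (w x); lra.
by lra.
Qed.

(** The corner of [phi (g * x)] divided by that of [phi x] is the last row of [phi g] applied to the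
    ball coordinates of [x], which converge to [xi]. *)
Lemma corner_ratio_cvg g : exists2 c : R, 0 <= c & forall e : R, 0 < e ->
  finite_set [set x | ~ (`|A (g * x)%g / A x - c| <= e)].
Proof.
have /choice[xi xiP] := ballc_cvg.
pose z := \sum_i phi g ord_max i * xi i.
pose w x := \sum_i phi g ord_max i * (ballc i x - xi i).
have lw : l2 w.
  apply: l2_sum => i; exact: l2Z.
exists (nsq z); first exact: nsq_ge0.
move=> e e0; apply: sub_finite_set (finite_far z lw e0) => x /=.
apply: contra_not; congr (`|_ - _| <= _).
have Ax : A x != 0 by rewrite gt_eqF// (lt_le_trans ltr01 (A_ge1 x)).
apply: (mulIf Ax); rewrite divfK// -nsqM; congr nsq.
rewrite phiM mxE /z /w -big_split mulr_suml /=; apply: eq_bigr => i _.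
by rewrite -mulrDr addrC subrK -mulrA divfK.
Qed.

Lemma corner_ratio_cvg1 g (e : R) : 0 < e ->
  finite_set [set x | ~ (`|A (g * x)%g / A x - 1| <= e)].
Proof.
have A0 x : 0 < A x := lt_le_trans ltr01 (A_ge1 x).
have AV0 x : 0 < (A x)^-1 by rewrite invr_gt0.
(* For the summable function 1 / [A], this is [no_contraction] after taking inverses. *)
have contr h (q : R) : 0 < q < 1 -> ~ finite_set [set x | ~ (A (h * x)%g <= q * A x)].
  move=> q01 fin; apply: (no_contraction (g := h) infL sA AV0 q01).
  apply: sub_finite_set fin => x /=; apply: contra_not => h1.
  by rewrite ler_pdivlMr// mulrC ler_pdivrMr.
have [c c0 cP] := corner_ratio_cvg g.
suff -> : 1 = c by exact: cP.
apply/eqP; rewrite eq_le; apply/andP; split; rewrite leNgt; apply/negP => c1.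
  pose d := (1 - c) / 2; have d0 : 0 < d by rewrite /d; lra.
  apply: (contr g (c + d)); first by rewrite /d; lra.
  apply: sub_finite_set (cP d d0) => x /=; apply: contra_not.
  by rewrite ler_distl => /andP[_ h]; rewrite -ler_pdivrMr.
pose d := (c - 1) / 2; have d0 : 0 < d by rewrite /d; lra.
have cd : 1 < c - d by rewrite /d; lra.
(* A limit above 1 for [g] is a contraction for the inverse, seen at the points [y = g * x]. *)
apply: (contr g^-1%g (c - d)^-1).
  by rewrite invr_gt0 invf_lt1; lra.
have fin := finite_image (fun x => g * x)%g (cP d d0).
apply: sub_finite_set fin => y /= hy; exists (g^-1 * y)%g; last first.
  by rewrite mulgA mulgV mul1g.
move: hy; apply: contra_not => /=; rewrite mulgA mulgV mul1g ler_distl => /andP[h _].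
by rewrite ler_pdivlMl; [rewrite -ler_pdivlMr|lra].
Qed.

Lemma corner_not_summable : False.
Proof.
have [c c0 gap] := spectral_gap S_gen L_nonamenable.
have A0 x : 0 < A x := lt_le_trans ltr01 (A_ge1 x).
have AV0 x : 0 < (A x)^-1 by rewrite invr_gt0.
apply: (@not_almost_invariant R L k S c (fun x => Num.sqrt (A x)^-1) c0 gap).
- rewrite (_ : (fun x => _) = (fun x => (A x)^-1))//.
  by apply/funext => x; rewrite sqr_sqrtr// ltW.
- by move=> x; rewrite sqrtr_gt0.
move=> j d d0.
(* The bound 1/2 gives [q <= 2 * p], so passing to inverses costs a factor 2, which [d / 2]
   compensates. *)
have d'0 : 0 < Num.min 2^-1 (d / 2) by rewrite lt_min invr_gt0 ltr0n divr_gt0.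
apply: sub_finite_set (corner_ratio_cvg1 (S j)^-1%g d'0) => x /=; apply: contra_not.
set p := A _; set q := A x; have p0 : 0 < p := A0 _; have q0 : 0 < q := A0 x.
rewrite le_min => /andP[h1 h2].
have p2 : q <= 2 * p.
  move: h1; rewrite ler_distl => /andP[+ _]; rewrite ler_pdivlMr//; lra.
have h3 : `|p^-1 - q^-1| <= d * q^-1.
  have -> : p^-1 - q^-1 = - ((p / q - 1) * p^-1) by field; rewrite !gt_eqF.
  have pV : p^-1 <= 2 * q^-1 by rewrite ler_pdivlMr// mulrC ler_pdivrMr.
  have pV0 : 0 < p^-1 by rewrite invr_gt0.
  have qV0 : 0 < q^-1 by rewrite invr_gt0.
  rewrite normrN normrM (gtr0_norm pV0).
  apply: (@le_trans _ _ (d / 2 * (2 * q^-1))); last by rewrite mulrA divfK.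
  by apply: ler_pM => //; exact: ltW.
by apply: dist_sqrt_le; rewrite ?invr_gt0.
Qed.

End Representation.

(** * Upper bounds for the distance from explicit geodesics *)

Section ExpCurve.
Context (R : realType) (n : nat).
Implicit Types (p q : 'cV[R]_n.+1) (a b d t : R).

(** A family stable under differentiation, which makes these curves [C1]. The parameter
    [(1 - t) * d] starts at distance [d] and reaches the origin at [t = 1]. *)
Definition expcurve p q d t : 'cV[R]_n.+1 :=
  expR ((1 - t) * d) *: p + expR (- ((1 - t) * d)) *: q.

Lemma is_derive_exp a b d t :
  is_derive t 1 (fun s => expR ((1 - s) * d) * a + expR (- ((1 - s) * d)) * b)
    (expR ((1 - t) * d) * (- d * a) + expR (- ((1 - t) * d)) * (d * b)).
Proof.
have h1 : is_derive t 1 (fun s : R => (1 - s) * d) (- d).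
  by apply: is_derive_eq; rewrite /GRing.scale /=; ring.
have h2 : is_derive t 1 (fun s : R => - ((1 - s) * d)) d.
  by apply: is_derive_eq; rewrite opprK.
have e1 := @is_derive1_comp R expR (fun s => (1 - s) * d) t _ _ (is_derive_expR _) h1.
have e2 := @is_derive1_comp R expR (fun s => - ((1 - s) * d)) t _ _ (is_derive_expR _) h2.
rewrite /comp in e1 e2.
by apply: is_derive_eq; rewrite /GRing.scale /=; ring.
Qed.

Lemma expcurve_derivable p q d t : derivable (expcurve p q d) t 1.
Proof.
apply/derivable_mxP => i j.
rewrite (_ : (fun s => _) = fun s => expR ((1 - s) * d) * p i j +
    expR (- ((1 - s) * d)) * q i j); last by apply/funext => s; rewrite !mxE.
exact: (@ex_derive _ _ _ _ _ _ _ (is_derive_exp (p i j) (q i j) d t)).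
Qed.

Lemma derive1_expcurve p q d : derive1 (expcurve p q d) = expcurve (- d *: p) (d *: q) d.
Proof.
apply/funext => t; rewrite derive1E derive_mx; last exact: expcurve_derivable.
apply/matrixP => i j; rewrite !mxE.
rewrite (_ : (fun s => _) = fun s => expR ((1 - s) * d) * p i j +
    expR (- ((1 - s) * d)) * q i j); last by apply/funext => s; rewrite !mxE.
exact: (@derive_val _ _ _ _ _ _ _ (is_derive_exp (p i j) (q i j) d t)).
Qed.

Lemma expcurve_C1 p q d : C1 (expcurve p q d).
Proof.
split; first by move=> t; exact: expcurve_derivable.
rewrite derive1_expcurve => t; apply: differentiable_continuous.
by apply/derivable1_diffP; exact: expcurve_derivable.
Qed.

End ExpCurve.

Lemma arcosh_bound (R : realType) (a : R) : 1 <= a -> exists d : R,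
  [/\ 0 <= d, expR d <= 2 * a & (expR d + expR (- d)) / 2 = a].
Proof.
move=> a1; pose r := Num.sqrt (a ^+ 2 - 1).
have a2 : 0 <= a ^+ 2 - 1 by rewrite subr_ge0 expr2; nra.
have rE : r ^+ 2 = a ^+ 2 - 1 by rewrite sqr_sqrtr.
have r0 : 0 <= r by exact: sqrtr_ge0.
have ra : r <= a by rewrite -(@ler_pXn2r _ 2)// ?nnegrE; lra.
have e0 : 0 < a + r by lra.
exists (ln (a + r)); rewrite expRN lnK ?posrE//; split.
- by rewrite ln_ge0//; lra.
- by lra.
(* The product of [a + r] and [a - r] is 1 by the choice of [r], so the sum of the exponentials is
   [2 * a]. *)
have -> : (a + r)^-1 = a - r; last by lra.
apply: (mulfI (lt0r_neq0 e0)); rewrite divff ?gt_eqF//.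
by move: rE; rewrite !expr2; lra.
Qed.

Lemma Rintegral01_cst (R : realType) (r : R) :
  \int[lebesgue_measure]_(t in `[0, 1]) r = r.
Proof.
rewrite Rintegral_cst//.
rewrite -[RHS]mulr1 -[X in _ = _ * X]/(fine 1%:E); congr (_ * fine _).
apply: eq_trans (lebesgue_measure_itv (`[0, 1] : interval R)) _.
by rewrite /= lte_fin ltr01 oppr0 adde0.
Qed.

Section HyperbolicFunctions.
Context (R : realType).
Implicit Types (d s Q : R).

Definition ch s : R := (expR s + expR (- s)) / 2.
Definition sh s : R := (expR s - expR (- s)) / 2.

Lemma ch0 : ch 0 = 1.
Proof. by rewrite /ch oppr0 expR0; field. Qed.

Lemma sh0 : sh 0 = 0.
Proof. by rewrite /sh oppr0 expR0; field. Qed.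

Lemma ch_gt0 s : 0 < ch s.
Proof. by rewrite divr_gt0// addr_gt0 ?expR_gt0. Qed.

Lemma sh_ch s : sh s ^+ 2 = ch s ^+ 2 - 1.
Proof.
have h : expR s * expR (- s) = 1 by rewrite -expRD subrr expR0.
rewrite /ch /sh; apply/eqP; rewrite -subr_eq0; apply/eqP.
rewrite (_ : _ - _ = 1 - expR s * expR (- s)); last by field.
by rewrite h subrr.
Qed.

Lemma sh_eq0 d : sh d = 0 -> d = 0.
Proof.
move=> /eqP; rewrite mulf_eq0 invr_eq0 pnatr_eq0 orbF subr_eq0 => /eqP/expR_inj.
by lra.
Qed.

(* Q is the squared length of the direction of the geodesic, which is a junk
   value when the geodesic is reduced to a point. *)
Lemma geodesic_identities d t Q : d = 0 \/ Q = 1 ->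
  let s := (1 - t) * d in
  [/\ sh s ^+ 2 * Q - ch s ^+ 2 = -1,
      (d * ch s) ^+ 2 * Q - (d * sh s) ^+ 2 = d ^+ 2 &
      d * ch s * sh s * Q - d * sh s * ch s = 0].
Proof.
move=> [->|->] s; first by rewrite /s mulr0 ch0 sh0; split; ring.
have := sh_ch s; move: (sh s) (ch s) => x y; rewrite !expr2 => h.
split; [lra| |ring].
rewrite (_ : _ - _ = d * d * (y * y - x * x)); last by ring.
by rewrite h; ring.
Qed.

Lemma arcosh_sh (a : R) : 1 <= a -> exists d, [/\ 0 <= d, expR d <= 2 * a, ch d = a &
  sh d ^+ 2 = a ^+ 2 - 1].
Proof.
move=> /arcosh_bound[d [d0 da dE]]; exists d; split=> //.
by rewrite sh_ch /ch dE.
Qed.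

End HyperbolicFunctions.

Section RealGeodesic.
Context (R : realType) (n : nat).
Implicit Types (x v : 'cV[R]_n.+1).

Let o := origin R n.
Let Q v : R := \sum_(i < n.+1 | i != ord_max) v i ord0 ^+ 2.

Definition geodesic v (d t : R) : 'cV[R]_n.+1 :=
  expcurve (2^-1 *: (o + v)) (2^-1 *: (o - v)) d t.

Lemma geodesicE v d t :
  geodesic v d t = ch ((1 - t) * d) *: o + sh ((1 - t) * d) *: v.
Proof. by apply/matrixP => i j; rewrite !mxE /ch /sh; field. Qed.

Lemma derive1_geodesic v d t : derive1 (geodesic v d) t =
  (- (d * sh ((1 - t) * d))) *: o + (- (d * ch ((1 - t) * d))) *: v.
Proof.
rewrite derive1_expcurve; apply/matrixP => i j.
by rewrite !mxE /ch /sh; field.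
Qed.

Lemma comb_max (a b : R) v : v ord_max ord0 = 0 ->
  (a *: o + b *: v) ord_max ord0 = a.
Proof. by move=> v0; rewrite /o !mxE !eqxx v0 mulr0 mulr1 addr0. Qed.

Lemma lorentz_comb (a b : R) v : v ord_max ord0 = 0 ->
  lorentz (a *: o + b *: v) = b ^+ 2 * Q v - a ^+ 2.
Proof.
move=> v0; rewrite /lorentz /o !mxE !eqxx v0 mulr0 mulr1 addr0 mulr_sumr.
congr (_ - _); apply: eq_bigr => i im.
by rewrite !mxE (negbTE im) mulr0 add0r exprMn.
Qed.

Lemma rdist_origin_le x : hyperboloid x ->
  exists d, rdist x o <= d /\ expR d <= 2 * x ord_max ord0.
Proof.
move=> [xl x0]; set a := x ord_max ord0 in x0 *.
have Qx : Q x = a ^+ 2 - 1 by move: xl; rewrite /lorentz -/(Q x) -/a; lra.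
have Q0 : 0 <= Q x by apply: sumr_ge0 => i _; exact: sqr_ge0.
have a1 : 1 <= a by rewrite -(@ler_pXn2r _ 2)// ?nnegrE; lra.
have [d [d0 da chd shd]] := arcosh_sh a1; exists d; split=> //.
(* [w] is the part of [x] orthogonal to the origin. If [x] is the origin, then [sh d = 0] and its
   inverse is 0 by convention, so [v = 0] and the curve is constant. *)
pose w := x - a *: o; pose v := (sh d)^-1 *: w.
have wm : w ord_max ord0 = 0 by rewrite !mxE !eqxx mulr1 subrr.
have vm : v ord_max ord0 = 0 by rewrite mxE wm mulr0.
have Qw : Q w = sh d ^+ 2.
  rewrite shd -Qx; apply: eq_bigr => i im.
  by rewrite !mxE (negbTE im) mulr0 subr0.
have shv : sh d *: v = w.
  have [s0|s0] := eqVneq (sh d) 0; last by rewrite scalerA divff// scale1r.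
  rewrite s0 scale0r; apply/matrixP => i j; rewrite ord1 mxE.
  have [->|im] := eqVneq i ord_max; first by rewrite wm.
  have /eqP : Q w = 0 by rewrite Qw s0 expr0n.
  rewrite psumr_eq0 => [/allP/(_ i)|k _]; last exact: sqr_ge0.
  by rewrite mem_index_enum im => /(_ isT); rewrite sqrf_eq0 => /eqP.
have dQ : d = 0 \/ Q v = 1.
  have [s0|s0] := eqVneq (sh d) 0; first by left; exact: sh_eq0.
  right; rewrite (_ : Q v = (sh d)^-1 ^+ 2 * Q w).
    by rewrite Qw -exprMn mulVf// expr1n.
  by rewrite /Q mulr_sumr; apply: eq_bigr => i _; rewrite mxE exprMn.
apply: ge_inf.
  exists 0 => _ [c [_ _ _ _ ->]]; apply: Rintegral_ge0 => t _.
  exact: sqrtr_ge0.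
exists (geodesic v d); split.
- exact: expcurve_C1.
- move=> t; rewrite geodesicE; have [h1 _ _] := geodesic_identities t dQ.
  split; first by rewrite lorentz_comb.
  by rewrite comb_max// ch_gt0.
- by rewrite geodesicE subr0 mul1r chd shv addrC subrK.
- by rewrite geodesicE subrr mul0r ch0 sh0 scale0r scale1r addr0.
rewrite /rlength -[LHS](@Rintegral01_cst R d).
congr (Rintegral _ _ _); apply/funext => t.
rewrite derive1_geodesic lorentz_comb// !sqrrN.
by have [_ -> _] := geodesic_identities t dQ; rewrite sqrtr_sqr ger0_norm.
Qed.

End RealGeodesic.

Section ComplexGeodesic.
Context (R : realType) (n : nat).
Implicit Types (z v : 'cV[R[i]]_n.+1) (a b d t : R).

Let o := origin R[i] n.
Let Q v : R := \sum_(i < n.+1 | i != ord_max) nsq (v i ord0).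

Definition ccomb a b v : 'cV[R[i]]_n.+1 := a%:C *: o + b%:C *: v.

Lemma nsqR a : nsq a%:C = a ^+ 2.
Proof. by rewrite /nsq /= expr0n addr0. Qed.

Lemma ccomb_max a b v : v ord_max ord0 = 0 -> ccomb a b v ord_max ord0 = a%:C.
Proof. by move=> v0; rewrite /ccomb /o !mxE !eqxx v0 mulr0 mulr1 addr0. Qed.

Lemma ccomb_other a b v i : i != ord_max -> ccomb a b v i ord0 = b%:C * v i ord0.
Proof. by move=> im; rewrite /ccomb /o !mxE (negbTE im) mulr0 add0r. Qed.

Lemma hform_ccomb a b v : v ord_max ord0 = 0 ->
  hform (ccomb a b v) = b ^+ 2 * Q v - a ^+ 2.
Proof.
move=> v0; rewrite hformE ccomb_max// nsqR mulr_sumr; congr (_ - _).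
by apply: eq_bigr => i im; rewrite ccomb_other// nsqM nsqR.
Qed.

Lemma herm_ccomb a b a' b' v : v ord_max ord0 = 0 ->
  herm (ccomb a b v) (ccomb a' b' v) = (b * b' * Q v - a * a')%:C.
Proof.
move=> v0; rewrite /herm !ccomb_max// rmorphB /= mulr_sumr raddf_sum /=; congr (_ - _).
  apply: eq_bigr => i im; rewrite !ccomb_other//.
  by case: (v i ord0) => x y; rewrite /nsq; simpc => /=; congr (_ +i* _); ring.
by simpc.
Qed.

Definition cgeodesic v d t : 'cV[R[i]]_n.+1 :=
  ccomb (ch ((1 - t) * d)) (sh ((1 - t) * d)) v.

Lemma re_cgeodesic v d : re_curve (cgeodesic v d) = geodesic (map_mx (@complex.Re R) v) d.
Proof.
apply/funext => t; rewrite geodesicE; apply/matrixP => i j; rewrite !mxE.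
by case: (v i j) => x y; case: eqP => _; case: eqP => _; simpc => /=; ring.
Qed.

Lemma im_cgeodesic v d : im_curve (cgeodesic v d) =
  expcurve (2^-1 *: map_mx (@complex.Im R) v) (- 2^-1 *: map_mx (@complex.Im R) v) d.
Proof.
apply/funext => t; apply/matrixP => i j; rewrite !mxE /ch /sh.
by case: (v i j) => x y; case: eqP => _; case: eqP => _; simpc => /=; field.
Qed.

Lemma velocity_cgeodesic v d t : velocity (cgeodesic v d) t =
  ccomb (- (d * sh ((1 - t) * d))) (- (d * ch ((1 - t) * d))) v.
Proof.
apply/matrixP => i j; rewrite (ord1 j) !mxE re_cgeodesic im_cgeodesic.
rewrite derive1_geodesic derive1_expcurve !mxE /ch /sh eqxx andbT.
by case: (v i 0) => x y; case: eqP => _; simpc => /=; congr (_ +i* _); field.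
Qed.

Lemma cdist_origin_le z : hform z = -1 ->
  exists d, cdist z o <= d /\ expR d <= 2 * Num.sqrt (nsq (z ord_max ord0)).
Proof.
move=> hz; set alpha := z ord_max ord0; set a := Num.sqrt (nsq alpha).
have Qz : Q z = nsq alpha - 1 by move: hz; rewrite hformE -/(Q z) -/alpha; lra.
have Q0 : 0 <= Q z by apply: sumr_ge0 => i _; exact: nsq_ge0.
have aE : a ^+ 2 = nsq alpha by rewrite sqr_sqrtr// nsq_ge0.
have a0 : 0 <= a by exact: sqrtr_ge0.
have a1 : 1 <= a by rewrite -(@ler_pXn2r _ 2)// ?nnegrE; lra.
have [d [d0 da chd shd]] := arcosh_sh a1; exists d; split=> //.
have ac0 : a%:C != 0 by rewrite eq_complex /= eqxx andbT gt_eqF//; lra.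
(* A unit scalar that makes the last coordinate real and positive; it changes the lift but not the
   line. *)
pose la := alpha^* / a%:C.
have laalpha : la * alpha = a%:C.
  apply: (mulIf ac0); rewrite mulrAC divfK// -rmorphM -expr2 aE.
  by case: (alpha) => x y; rewrite /nsq; simpc; congr (_ +i* _); ring.
have la1 : nsq la = 1.
  have := congr1 (@nsq R) laalpha; rewrite nsqM nsqR aE.
  have al0 : nsq alpha != 0 by rewrite gt_eqF//; lra.
  by move=> h; apply: (mulIf al0); rewrite h mul1r.
have la0 : la != 0 by apply/eqP => l0; move: la1; rewrite l0 nsq0; lra.
pose w := la *: z - a%:C *: o; pose v := ((sh d)^-1)%:C *: w.
have wm : w ord_max ord0 = 0 by rewrite !mxE !eqxx mulr1 -/alpha laalpha subrr.
have vm : v ord_max ord0 = 0 by rewrite mxE wm mulr0.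
have Qw : Q w = sh d ^+ 2.
  rewrite shd aE -Qz; apply: eq_bigr => i im.
  by rewrite !mxE (negbTE im) mulr0 subr0 nsqM la1 mul1r.
have shv : (sh d)%:C *: v = w.
  have [s0|s0] := eqVneq (sh d) 0.
    rewrite s0 scale0r; apply/matrixP => i j; rewrite ord1 mxE.
    have [->|im] := eqVneq i ord_max; first by rewrite wm.
    have /eqP : Q w = 0 by rewrite Qw s0 expr0n.
    rewrite psumr_eq0 => [/allP/(_ i)|k _]; last exact: nsq_ge0.
    by rewrite mem_index_enum im => /(_ isT)/eqP/nsq_eq0.
  by rewrite scalerA -rmorphM /= divff// scale1r.
have dQ : d = 0 \/ Q v = 1.
  have [s0|s0] := eqVneq (sh d) 0; first by left; exact: sh_eq0.
  right; rewrite (_ : Q v = (sh d)^-1 ^+ 2 * Q w).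
    by rewrite Qw -exprMn mulVf// expr1n.
  by rewrite /Q mulr_sumr; apply: eq_bigr => i _; rewrite mxE nsqM nsqR.
apply: ge_inf.
  exists 0 => _ [c [_ _ _ _ ->]]; apply: Rintegral_ge0 => t _.
  exact: sqrtr_ge0.
exists (cgeodesic v d); split.
- by rewrite re_cgeodesic im_cgeodesic; split; exact: expcurve_C1.
- move=> t; have [h1 _ _] := geodesic_identities t dQ.
  by rewrite hform_ccomb// h1 ltrN10.
- exists la => //.
  by rewrite /cgeodesic /ccomb subr0 mul1r chd shv addrC subrK.
- exists 1; first exact: oner_neq0.
  by rewrite /cgeodesic /ccomb subrr mul0r ch0 sh0 !scale1r scale0r addr0.
rewrite /clength -[LHS](@Rintegral01_cst R d).
congr (Rintegral _ _ _); apply/funext => t.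
(* The velocity is orthogonal to the lift, whose form is -1, so [bergman] reduces to the form of the
   velocity, [d ^+ 2]. *)
have [h1 h2 h3] := geodesic_identities t dQ.
rewrite /bergman velocity_cgeodesic herm_ccomb// !hform_ccomb// h1 nsqE nsqR !sqrrN.
rewrite h2 (_ : _ * Q v - _ = 0) ?expr0n ?sub0r ?mulrN1 ?opprK ?expr1n ?divr1.
  by rewrite sqrtr_sqr ger0_norm.
by rewrite -oppr0 -h3; ring.
Qed.

End ComplexGeodesic.

Lemma inf_ge0 (R : realType) (E : set R) : (forall x, E x -> 0 <= x) -> 0 <= inf E.
Proof.
move=> E0; have [[x Ex]|nE] := pselect (E !=set0).
  by apply: lb_le_inf; [exists x|exact: E0].
by rewrite (_ : E = set0) ?inf0//; apply/eqP; apply: contra_notT nE => /set0P.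
Qed.

Lemma rdisp_ge0 (R : realType) (n : nat) (A : 'M[R]_n.+1) : 0 <= rdisp A.
Proof.
apply: inf_ge0 => _ [c [_ _ _ _ ->]]; apply: Rintegral_ge0 => t _.
exact: sqrtr_ge0.
Qed.

Lemma cdisp_ge0 (R : realType) (n : nat) (A : 'M[R[i]]_n.+1) : 0 <= cdisp A.
Proof.
apply: inf_ge0 => _ [c [_ _ _ _ ->]]; apply: Rintegral_ge0 => t _.
exact: sqrtr_ge0.
Qed.

(** With nonnegative displacements, convergence at some [s < 2] would give convergence at 2 by
    comparison. *)
Lemma critical_exponent_ge2 (R : realType) (T : choiceType) (D : T -> R) (A : set T) :
  (forall x, 0 <= D x) -> poincare D A 2 = +oo%E ->
  (2%:E <= critical_exponent D A)%E.
Proof.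
move=> D0 div2; apply: le_ereal_inf_tmp => _ [s [s0 cvs] <-].
rewrite lee_fin leNgt; apply/negP => s2.
have : (poincare D A 2 <= poincare D A s)%E.
  apply: le_esum => x _; rewrite lee_fin ler_expR lerN2.
  by have := D0 x; nra.
by rewrite div2 leye_eq => /eqP h; rewrite h in cvs.
Qed.

(** Squaring [expR d <= 2 * Num.sqrt (f g)] gives [(f g)^-1 <= 4 * expR (- (2 * d))], and replacing
    [d] by the smaller displacement only enlarges the right side. *)
Lemma poincare2_summable (R : realType) (L : groupType) (T : choiceType)
    (phi : L -> T) (D : T -> R) (f : L -> R) : injective phi ->
  (forall g, exists d, D (phi g) <= d /\ expR d <= 2 * Num.sqrt (f g)) ->
  (forall g, 0 < f g) -> (poincare D (range phi) 2 < +oo)%E ->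
  rsummable (fun g => (f g)^-1).
Proof.
move=> inj dP f0; rewrite /poincare esum_image; last by move=> x y _ _; exact: inj.
move=> sE.
have : rsummable (fun g => 4 * expR (- (2 * D (phi g)))).
  apply: rsummableZ; apply: le_lt_trans sE; apply: le_esum => g _.
  by rewrite ger0_norm ?expR_ge0.
apply: rsummable_le => g; rewrite ger0_norm ?invr_ge0 ?(ltW (f0 g))//.
have [d [Dd ed]] := dP g.
apply: (@le_trans _ _ (4 * expR (- (2 * d)))); last first.
  by rewrite ler_pM2l// ler_expR lerN2 ler_pM2l.
have e2 : expR (2 * d) <= 4 * f g.
  have -> : expR (2 * d) = expR d ^+ 2 by rewrite -expRM_natl.
  have -> : 4 * f g = (2 * Num.sqrt (f g)) ^+ 2.
    by rewrite exprMn sqr_sqrtr ?(ltW (f0 g))//; ring.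
  by apply: lerXn2r; rewrite ?nnegrE ?expR_ge0// mulr_ge0// sqrtr_ge0.
rewrite expRN ler_pdivlMr ?expR_gt0// mulrC ler_pdivrMr//.
Qed.

(** * Reduction of the real group to the Hermitian form *)

Section RealCase.
Context (R : realType) (n : nat).
Implicit Types (A : 'M[R]_n.+1).

Lemma lorentz_origin : lorentz (origin R n) = -1.
Proof.
rewrite /lorentz mxE !eqxx expr1n big1 ?sub0r// => i im.
by rewrite mxE (negbTE im) expr0n.
Qed.

Lemma corner_sqr_ge1 A : (forall x, lorentz (A *m x) = lorentz x) ->
  1 <= A ord_max ord_max ^+ 2.
Proof.
move=> Al; have := Al (origin R n); rewrite lorentz_origin /lorentz mul_origin.
set s := \sum_(i < _ | _) _ => h.
have : 0 <= s by apply: sumr_ge0 => i _; exact: sqr_ge0.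
by lra.
Qed.

Lemma SO1_lorentz A : SO1 A -> forall x, lorentz (A *m x) = lorentz x.
Proof. by move=> [C [_ CG _] /CG[]]. Qed.

(* The corner entry does not vanish on the group preserving the form, so its
   sign is constant on connected sets. *)
Lemma SO1_corner_gt0 A : SO1 A -> 0 < A ord_max ord_max.
Proof.
move=> [C [C1 CG conC] CA]; rewrite ltNge; apply/negP => A0.
pose f (M : 'M[R]_n.+1) := M ord_max ord_max.
have : connected (f @` C).
  apply: connected_continuous_connected => //.
  by apply: continuous_subspaceT; exact: coord_continuous.
move=> /connected_intervalP itv; have := itv (f A) (f 1%:M).
move=> /(_ (ex_intro2 _ _ A CA erefl) (ex_intro2 _ _ 1%:M C1 erefl) 0).
rewrite A0 /= /f mxE eqxx ler01 => /(_ isT)[M CM M0].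
have [_ Ml] := CG M CM; have := corner_sqr_ge1 Ml.
by rewrite M0 expr0n /= ler10.
Qed.

Lemma SO1_rdisp_le A : SO1 A -> exists d,
  rdisp A <= d /\ expR d <= 2 * Num.sqrt (A ord_max ord_max ^+ 2).
Proof.
move=> SA; have A0 := SO1_corner_gt0 SA.
have [|d [h1 h2]] := @rdist_origin_le R n (A *m origin R n).
  by split; [rewrite SO1_lorentz// lorentz_origin|rewrite mul_origin].
by exists d; split=> //; rewrite sqrtr_sqr ger0_norm ?(ltW A0)// -mul_origin.
Qed.

(** A real matrix acts separately on real and imaginary parts, and [hform] is the sum of their
    Lorentz forms. *)
Lemma complexify_hform A : (forall x, lorentz (A *m x) = lorentz x) ->
  forall z, hform (map_mx (real_complex R) A *m z) = hform z.
Proof.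
move=> Al z.
have hE (w : 'cV[R[i]]_n.+1) :
    hform w = lorentz (map_mx (@complex.Re R) w) + lorentz (map_mx (@complex.Im R) w).
  rewrite hformE /lorentz !mxE addrACA -opprD -big_split; congr (_ - _).
  by apply: eq_bigr => i _; rewrite !mxE.
have reE : map_mx (@complex.Re R) (map_mx (real_complex R) A *m z) =
    A *m map_mx (@complex.Re R) z.
  apply/matrixP => i j; rewrite !mxE.
  rewrite (big_morph (@complex.Re R) (id1 := 0) (op1 := +%R))//; last by move=> [? ?] [? ?].
  by apply: eq_bigr => k _; rewrite !mxE; case: (z k j) => x y; simpc.
have imE : map_mx (@complex.Im R) (map_mx (real_complex R) A *m z) =
    A *m map_mx (@complex.Im R) z.
  apply/matrixP => i j; rewrite !mxE.
  rewrite (big_morph (@complex.Im R) (id1 := 0) (op1 := +%R))//; last by move=> [? ?] [? ?].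
  by apply: eq_bigr => k _; rewrite !mxE; case: (z k j) => x y; simpc.
by rewrite !hE reE imE !Al.
Qed.

End RealCase.

Theorem theorem1p5 (R : realType) (L : groupType)
    (k : nat) (S : 'I_k -> L) (S_gen : generates S)
    (L_nonamenable : ~ amenable L R)
    (L_betti1 : l2betti1 R S = 0)
    (n : nat) (n_ge2 : (2 <= n)%N) :
  (forall phi : L -> 'M[R]_n.+1,
     faithful_rep (@SO1 R n) phi ->
     discrete_set (range phi) ->
     (2%:E <= critical_exponent (@rdisp R n) (range phi))%E /\
     (critical_exponent (@rdisp R n) (range phi) = 2%:E ->
      poincare (@rdisp R n) (range phi) 2 = +oo%E))
  /\
  (forall phi : L -> 'M[R[i]]_n.+1,
     faithful_rep (@SU1 R n) phi ->
     discrete_set (range phi : set 'M[R[i]^o]_n.+1) ->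
     (2%:E <= critical_exponent (@cdisp R n) (range phi))%E /\
     (critical_exponent (@cdisp R n) (range phi) = 2%:E ->
      poincare (@cdisp R n) (range phi) 2 = +oo%E)).
Proof.
split=> phi [phiG phiM phi_inj] _.
  (* Divergence at 2 is the second claim outright, and yields the first by comparison. *)
  suff div2 : poincare (@rdisp R n) (range phi) 2 = +oo%E.
    by split=> //; apply: critical_exponent_ge2 => //; exact: rdisp_ge0.
  apply/eqP; rewrite eq_le leey leNgt /=; apply/negP => cv2.
  have phil g := SO1_lorentz (phiG g).
  have s2 : rsummable (fun g => (phi g ord_max ord_max ^+ 2)^-1).
    apply: poincare2_summable phi_inj _ _ cv2 => g; first exact: SO1_rdisp_le.
    by rewrite exprn_gt0// SO1_corner_gt0.
  apply: (@corner_not_summable R L n (fun g => map_mx (real_complex R) (phi g)) _ _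
    k S S_gen L_nonamenable L_betti1).
  - by move=> g h; rewrite phiM map_mxM.
  - by move=> g; exact: complexify_hform.
  - by apply: rsummable_le s2 => g; rewrite mxE nsqR ger0_norm ?invr_ge0 ?sqr_ge0.
suff div2 : poincare (@cdisp R n) (range phi) 2 = +oo%E.
  by split=> //; apply: critical_exponent_ge2 => //; exact: cdisp_ge0.
apply/eqP; rewrite eq_le leey leNgt /=; apply/negP => cv2.
have phih g z : hform (phi g *m z) = hform z by have [_] := phiG g; exact.
apply: (@corner_not_summable R L n phi phiM phih k S S_gen L_nonamenable L_betti1).
apply: poincare2_summable phi_inj _ _ cv2 => g.
  have [|d] := @cdist_origin_le R n (phi g *m origin R[i] n).
    by rewrite phih hform_origin.
  by rewrite mul_origin; exists d.
exact: lt_le_trans ltr01 (nsq_corner_ge1 (phih g)).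
Qed.
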